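(* Let $\Omega \subset \mathbb{C}$ be a smooth (i.e. with smooth boundary), simply-connected, bounded quadrature domain of order $n$ with a single quadrature node ($L=1$); i.e., the conformal mapping $\phi:\mathbb{D}\to\Omega$ (sending $0$ to the node) is a polynomial of degree $n$. Then the number $N$ of critical points in $\Omega$ of the landscape function $v$ of $\Omega$ satisfies $$N \leq (2n-1)^2.$$
   Context: $\mathbb{D}$ denotes the open unit disk in $\mathbb{C}$. The landscape function $v$ of a bounded domain $\Omega\subset\mathbb{C}$ is the unique solution of $\Delta v = -2$ in $\Omega$, $v=0$ on $\partial\Omega$. A critical point of $v$ is a point $z\in\Omega$ with $\nabla v(z)=0$; $N$ counts distinct points. A bounded domain $\Omega\subset\mathbb{C}$ is a quadrature domain if there are finitely many points (nodes) $z_1,\dots,z_L\in\Omega$, integers $n_m\ge 0$ and constants $a_{m,k}\in\mathbb{C}$ (with $a_{m,n_m}\neq 0$) such that $$\int_{\Omega} g(z)\, dA(z) = \sum_{m=1}^{L}\sum_{k=0}^{n_m} a_{m,k}\, g^{(k)}(z_m)$$ for every integrable analytic function $g$ on $\Omega$, where $dA$ is area measure and the $z_m$, $a_{m,k}$ do not depend on $g$. The order of $\Omega$ is $\sum_{m=1}^L (n_m+1)$, i.e. the number of nodes counted with multiplicity. It is a known fact that a simply-connected domain is a quadrature domain of order $n$ with $L=1$ if and only if the conformal map $\phi$ from $\mathbb{D}$ onto $\Omega$ with $\phi(0)=z_1$ is a polynomial of degree $n$. *)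

(* Defs.v *)
From HB Require Import structures.
From mathcomp Require Import all_boot all_order all_algebra.
From mathcomp Require Import all_classical all_reals all_analysis.
From mathcomp Require Import complex.
Set Implicit Arguments.
Unset Strict Implicit.
Unset Printing Implicit Defensive.
Import Order.TTheory GRing.Theory Num.Theory.
Import numFieldNormedType.Exports.
Local Open Scope ring_scope.
Local Open Scope complex_scope.
Local Open Scope classical_set_scope.

(* [R[i]] with the topology of its modulus, as a normed module over itself, so
   that [derivable f z 1] and [derive1 f] are the complex derivative whenever
   [f : R[i] -> R[i]]. *)
HB.instance Definition _ (R : realType) := NormedModule.copy R[i] R[i]^o.

Definition boundary (R : realType) (A : set R[i]) : set R[i] :=
  closure A `\` interior A.

Definition bounded_domain (R : realType) (Omega : set R[i]) : Prop :=
  [/\ open Omega, connected Omega, Omega !=set0 & bounded_set Omega].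

Definition unit_disk (R : realType) : set R[i] := ball (0 : R[i]) 1.

(* Every loop is null-homotopic with fixed base point, [H (s, t)] being the
   point of parameter [t] at time [s]. *)
Definition simply_connected (R : realType) (Omega : set R[i]) : Prop :=
  let I := `[0, 1] : set R in
  forall gamma : R -> R[i],
    {within I, continuous gamma} ->
    (forall t, I t -> Omega (gamma t)) ->
    gamma 0 = gamma 1 ->
    exists H : R * R -> R[i],
      [/\ {within I `*` I, continuous H},
          forall st, (I `*` I) st -> Omega (H st),
          forall t, I t -> H (0, t) = gamma t,
          forall t, I t -> H (1, t) = gamma 0 &
          forall s, I s -> H (s, 0) = gamma 0 /\ H (s, 1) = gamma 0].

Definition partial_x (R : realType) (f : R[i] -> R) (z : R[i]) : R :=
  derive1 (fun t : R => f (t +i* complex.Im z)) (complex.Re z).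

Definition partial_y (R : realType) (f : R[i] -> R) (z : R[i]) : R :=
  derive1 (fun t : R => f (complex.Re z +i* t)) (complex.Im z).

Definition has_partials (R : realType) (f : R[i] -> R) (z : R[i]) : Prop :=
  derivable (fun t : R => f (t +i* complex.Im z)) (complex.Re z) 1 /\
  derivable (fun t : R => f (complex.Re z +i* t)) (complex.Im z) 1.

(* [f] is of class C^k on the open set [U]: all the iterated partial
   derivatives of order at most [k] exist on [U], and those of order [k] are
   continuous there (hence so are the lower ones). *)
Fixpoint class_C (R : realType) (k : nat) (U : set R[i]) (f : R[i] -> R) : Prop :=
  if k is k'.+1 then
    [/\ forall z, U z -> has_partials f z,
        class_C k' U (partial_x f) & class_C k' U (partial_y f)]
  else forall z, U z -> {for z, continuous f}.

Definition laplacian (R : realType) (f : R[i] -> R) (z : R[i]) : R :=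
  partial_x (partial_x f) z + partial_y (partial_y f) z.

(* Near each of its boundary points [Omega] is a strict sublevel set of a
   C^oo function without critical points: a local defining function. *)
Definition smooth_boundary (R : realType) (Omega : set R[i]) : Prop :=
  forall p, boundary Omega p ->
    exists (U : set R[i]) (rho : R[i] -> R),
      [/\ open U, U p,
          forall k, class_C k U rho,
          forall z, U z -> (Omega z <-> rho z < 0) &
          forall z, U z -> ~ (partial_x rho z = 0 /\ partial_y rho z = 0)].

Definition analytic_on (R : realType) (U : set R[i]) (g : R[i] -> R[i]) : Prop :=
  forall z, U z -> derivable g z 1.

Definition conformal_map (R : realType) (U V : set R[i]) (phi : R[i] -> R[i]) :
    Prop :=
  analytic_on U phi /\ set_bij U V phi.

Definition cplx (R : realType) (p : R * R) : R[i] := p.1 +i* p.2.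

Definition area (R : realType) :
    {measure set (measurableTypeR R * measurableTypeR R) -> \bar R} :=
  (@lebesgue_measure R \x @lebesgue_measure R)%E.

Definition area_integrable (R : realType) (U : set R[i]) (g : R[i] -> R[i]) :
    Prop :=
  (@area R).-integrable (@cplx R @^-1` U)
    (fun p => (complex.Re (g (cplx p)))%:E) /\
  (@area R).-integrable (@cplx R @^-1` U)
    (fun p => (complex.Im (g (cplx p)))%:E).

Definition area_integral (R : realType) (U : set R[i]) (g : R[i] -> R[i]) :
    R[i] :=
  (\int[@area R]_(p in @cplx R @^-1` U) complex.Re (g (cplx p))) +i*
  (\int[@area R]_(p in @cplx R @^-1` U) complex.Im (g (cplx p))).

(* [Omega], a bounded domain, is a quadrature domain of order [n] with the [L]
   (distinct) nodes [z m]; the integer [d m] is the highest order of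
   derivative at the node [z m], and [a m k] is only used for [k <= d m]. *)
Definition quadrature_domain (R : realType) (Omega : set R[i]) (n : nat)
    (L : nat) (z : 'I_L -> R[i]) : Prop :=
  injective z /\ (forall m, Omega (z m)) /\
  exists (d : 'I_L -> nat) (a : 'I_L -> nat -> R[i]),
    [/\ forall m, a m (d m) != 0,
        forall g : R[i] -> R[i], analytic_on Omega g -> area_integrable Omega g ->
          area_integral Omega g =
            \sum_(m < L) \sum_(k < (d m).+1) a m k * derive1n k g (z m) &
        n = (\sum_(m < L) (d m).+1)%N].

(* [v] is the landscape function of [Omega], i.e. the classical solution of
   the Dirichlet problem [Delta v = -2] with zero boundary values. *)
Definition landscape_function (R : realType) (Omega : set R[i])
    (v : R[i] -> R) : Prop :=
  [/\ class_C 2 Omega v,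
      {within closure Omega, continuous v},
      forall z, Omega z -> laplacian v z = - 2 &
      forall z, boundary Omega z -> v z = 0].

Definition critical_points (R : realType) (Omega : set R[i]) (v : R[i] -> R) :
    set R[i] :=
  [set z | [/\ Omega z, partial_x v z = 0 & partial_y v z = 0]].

(* Main.v *)
(* Let [p] be the polynomial conformal map. On the unit circle |p|^2 = 2 Re Q for a
   polynomial [Q] of degree at most [n], so by the maximum principle
   v o p = Re Q - |p|^2 / 2 on the disk, and the critical points of [v] are the images
   of the zeros [x] in the disk of f(x, y) = Q'(x) - p'(x) conj(p)(y), y = x^*.
   Such zeros are common zeros of [f] and of its adjoint, and the resultant of two
   coprime polynomials of these bidegrees has degree at most
   (n - 1)^2 + n^2 <= (2n - 1)^2.

   The common factor [c] of [f] and its adjoint can be taken real at the points y = x^*,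
   and it has no zero in the disk: by a Hopf-type computation [f] does not vanish on the
   circle, while [c] changes sign at each of its zeros; so if [c] had a zero in the disk,
   one of the sets {c < 0}, {c > 0} would be nonempty and compactly contained in the
   disk. On its boundary the harmonic function f / p' = Q' / p' - conj(p) vanishes, which
   contradicts the strict subharmonicity of |f / p'|^2.

   All differential arguments are made on second-order expansions in h and conj(h), and
   the maximum principle comes from averaging over the points i^m h. *)

Require Import Defs.
From mathcomp Require Import all_boot all_order all_algebra.
From mathcomp Require Import all_classical all_reals all_analysis.
From mathcomp Require Import complex ring lra.
Set Implicit Arguments.
Unset Strict Implicit.
Unset Printing Implicit Defensive.
Import Order.TTheory GRing.Theory Num.Theory.
Import numFieldNormedType.Exports.
Local Open Scope ring_scope.
Local Open Scope complex_scope.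
Local Open Scope classical_set_scope.

(* Makes [^*] denote [conjc] in both scopes. *)
Local Notation "x ^*" := (conjc x) : ring_scope.

(** * Common factors in two variables *)

Section CommonFactor.
Variable K : closedFieldType.
Implicit Types (u d e f g : {poly {poly K}}) (r a : {poly K}).

(** A degree count bounds nothing if the common zeros may contain a curve, and [f] may share a
    factor with its adjoint. Algebra cannot exclude this: a self-adjoint polynomial may well vanish
    along a real curve. Hence the analytic treatment of the common factor, which rests on [p']
    having no zero in the disk.

    The degrees: [f] has degree at most n - 1 in x and n in y, and its adjoint has them exchanged.
    Eliminating y thus gives a determinant with at most n - 1 rows of degree n - 1 and n rows of
    degree n in x.

    Univalence is used through factorization: the quotient of p - p(r) by X - r has no root in the
    open disk, which bounds it below. This yields both the nonvanishing of [p'] and the fact that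
    the circle goes to the boundary of [Omega].

    Gauss's lemma breaks down when [f] vanishes identically in x for some y. In that case all
    critical points coincide. *)

Lemma spec_eq0_factor u (x : K) :
  map_poly (horner_eval x) u = 0 -> exists u', u = ('X - x%:P)%:P * u'.
Proof.
move=> u0.
have dv i : exists q, u`_i == q * ('X - x%:P).
  have : root u`_i x.
    by have /(congr1 (fun p : {poly K} => p`_i)) := u0;
      rewrite coef_map coef0 /= /horner_eval => /rootP.
  by move=> /factor_theorem [q ->]; exists q.
exists (\poly_(i < size u) xchoose (dv i)).
apply/polyP => i; rewrite coefCM coef_poly.
case: ltnP => iu; last by rewrite mulr0 nth_default.
by rewrite mulrC -(eqP (xchooseP (dv i))).
Qed.

(* In [{poly {poly K}}], the inner variable is [x] and the outer one is [y]. *)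
Definition inner_primitive d := forall x : K, map_poly (horner_eval x) d != 0.

(** Gauss's lemma, one linear factor of [r] at a time: at a root [x] of [r] the specialization of
    [e * d] vanishes while that of [d] does not, so ['X - x%:P] divides [e]. *)
Lemma gauss_cancel r d e f : r != 0 -> inner_primitive d ->
  r%:P * f = e * d -> exists e', f = e' * d.
Proof.
move=> r0 dP; have [m] := ubnP (size r).
elim: m r r0 e => // m IHm r r0 e; rewrite ltnS => rm fe.
have [r1|r1] := eqVneq (size r) 1%N.
  move/eqP: r1 => /size_poly1P [c c0 rc].
  exists (c^-1%:P%:P * e).
  rewrite -mulrA -fe rc mulrA -!polyCM mulVf // !polyC1 mul1r //.
have /closed_rootP [x /factor_theorem [r' rE]] := r1.
have r'0 : r' != 0 by apply: contraNneq r0; rewrite rE => ->; rewrite mul0r.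
have : map_poly (horner_eval x) e = 0.
  have := congr1 (map_poly (horner_eval x)) fe.
  rewrite !rmorphM /= map_polyC /= /horner_eval rE hornerM hornerXsubC subrr mulr0 mul0r.
  by move/esym/eqP; rewrite mulf_eq0 (negbTE (dP x)) orbF => /eqP.
move=> /spec_eq0_factor [e' eE].
apply: (IHm r' r'0 e').
  by move: rm; rewrite rE size_Mmonic ?monicXsubC // size_XsubC addn2.
have X0 : ('X - x%:P)%:P != 0 :> {poly {poly K}} by rewrite polyC_eq0 polyXsubC_eq0.
apply: (mulfI X0).
by rewrite mulrA -polyCM [('X - _) * _]mulrC -rE fe eE mulrA.
Qed.

(** Each failure of primitivity strips a factor ['X - x%:P], which lowers the degree in x of the
    leading coefficient. *)
Lemma primitive_part d : d != 0 ->
  exists r d', [/\ r != 0, inner_primitive d' & d = r%:P * d'].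
Proof.
have [m] := ubnP (size (lead_coef d)).
elim: m d => // m IHm d; rewrite ltnS => dm d0.
have [dP|] := pselect (inner_primitive d).
  by exists 1, d; rewrite oner_neq0 mul1r.
move=> /existsNP [x /negP /negPn /eqP /spec_eq0_factor [d1 dE]].
have X0 : ('X - x%:P)%:P != 0 :> {poly {poly K}} by rewrite polyC_eq0 polyXsubC_eq0.
have d10 : d1 != 0 by apply: contraNneq d0; rewrite dE => ->; rewrite mulr0.
have [] := IHm d1 _ d10.
  move: dm; rewrite dE lead_coefM lead_coefC mulrC size_Mmonic ?monicXsubC ?lead_coef_eq0 //.
  by rewrite size_XsubC addn2.
move=> r [d' [r0 d'P d1E]].
exists (('X - x%:P) * r), d'; split => //.
  by rewrite mulf_neq0 // polyXsubC_eq0.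
by rewrite polyCM -mulrA -d1E.
Qed.

(** Over the domain K[x], [gcdp] divides [f] and [g] only up to a nonzero factor in K[x]. Its
    primitive part divides them exactly, by [gauss_cancel], and has positive degree in y as long as
    the resultant vanishes, so the degree of [f] drops. *)
Lemma coprime_cofactors f g : f != 0 -> g != 0 ->
  exists c f1 g1, [/\ f = c * f1, g = c * g1 & resultant f1 g1 != 0].
Proof.
have [m] := ubnP (size f).
elim: m f g => // m IHm f g; rewrite ltnS => fm f0 g0.
have [/eqP|r0] := eqVneq (resultant f g) 0; last by exists 1, f, g; rewrite !mul1r.
rewrite resultant_eq0 => d1.
have d0 : gcdp f g != 0 by rewrite gcdp_eq0 negb_and f0.
have [r [d [r0 dP dE]]] := primitive_part d0.
have sd : (size d > 1)%N by move: d1; rewrite dE size_Cmul.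
have div h : gcdp f g %| h -> exists h', h = h' * d.
  move=> /Pdiv.Idomain.dvdpP [[c q] /= c0 E].
  apply: (@gauss_cancel c d (q * r%:P)) => //.
  by rewrite mul_polyC E dE mulrA.
have [f' fE] := div f (dvdp_gcdl _ _).
have [g' gE] := div g (dvdp_gcdr _ _).
have f'0 : f' != 0 by apply: contraNneq f0; rewrite fE => ->; rewrite mul0r.
have g'0 : g' != 0 by apply: contraNneq g0; rewrite gE => ->; rewrite mul0r.
have d'0 : d != 0 by rewrite -size_poly_gt0 (ltn_trans _ sd).
have [|c [f1 [g1 [f1E g1E r1]]]] := IHm f' g' _ f'0 g'0.
  apply: leq_trans fm; rewrite fE size_mul //.
  by case: (size d) sd => [|[|k]] // _; rewrite !addnS /= ltnS leq_addr.
exists (d * c), f1, g1; split => //.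
- by rewrite fE f1E; rewrite mulrC mulrA.
- by rewrite gE g1E; rewrite mulrC mulrA.
Qed.

Lemma sizeY_mul u d : u != 0 -> d != 0 -> sizeY (u * d) = (sizeY u + sizeY d).-1.
Proof. by move=> u0 d0; rewrite !sizeYE rmorphM /= size_mul ?swapXY_eq0. Qed.

End CommonFactor.

(** * Degree of the eliminant *)

Section Eliminant.
Variable K : idomainType.

Lemma size_det_leq m (A : 'M[{poly K}]_m) (b : 'I_m -> nat) :
  (forall i j, (size (A i j) <= (b i).+1)%N) ->
  (size (\det A) <= (\sum_i b i).+1)%N.
Proof.
move=> Ab; rewrite /determinant.
apply: (leq_trans (size_sum _ _ _)); apply/bigmax_leqP => s _.
rewrite -signr_odd; case: (odd _); rewrite ?expr1 ?expr0 ?mulN1r ?mul1r ?size_polyN.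
all: apply: (leq_trans (size_poly_prod_leq _ _)).
all: rewrite leq_subLR addnS ltnS.
all: have -> : (#|'I_m| + \sum_i b i = \sum_i (b i).+1)%N
  by rewrite -sum1_card -big_split.
all: by apply: leq_sum => i _; exact: Ab.
Qed.

Lemma size_resultant_leq (f g : {poly {poly K}}) a b :
  (sizeY f <= a.+1)%N -> (sizeY g <= b.+1)%N ->
  (size (resultant f g) <= ((size g).-1 * a + (size f).-1 * b).+1)%N.
Proof.
move=> fa gb; rewrite /resultant.
(* The Sylvester matrix has [(size g).-1] rows of coefficients of [f], then [(size f).-1] rows of
   coefficients of [g]; [B] bounds the degree in x along each row. *)
pose B (i : 'I_((size g).-1 + (size f).-1)) := if fintype.split i is inl _ then a else b.
have -> : ((size g).-1 * a + (size f).-1 * b = \sum_i B i)%N.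
  rewrite big_split_ord /= (eq_bigr (fun=> a)); last first.
    by move=> i _; rewrite /B (unsplitK (inl i)).
  rewrite [X in (_ = _ + X)%N](eq_bigr (fun=> b)); last first.
    by move=> i _; rewrite /B (unsplitK (inr i)).
  by rewrite !sum_nat_const !card_ord.
apply: size_det_leq => i j; rewrite Sylvester_mxE /B.
have H (u : {poly {poly K}}) c k (t : bool) : (sizeY u <= c.+1)%N -> (size (u`_k *+ t) <= c.+1)%N.
  by move=> uc; case: t; rewrite ?mulr0n ?size_poly0 // mulr1n (leq_trans (max_size_coefXY _ _)).
by case: (fintype.split i) => k; exact: H.
Qed.

Lemma eliminant (f g : {poly {poly K}}) m k a b :
  f != 0 -> g != 0 -> resultant f g != 0 ->
  (size f <= m.+1)%N -> (size g <= k.+1)%N ->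
  (sizeY f <= a.+1)%N -> (sizeY g <= b.+1)%N -> (a <= b)%N -> (0 < m)%N ->
  exists r u v, [/\ r != 0, r%:P = u * f + v * g & (size r <= (k * a + m * b).+1)%N].
Proof.
move=> f0 g0 r0 fm gk fa gb ab m0.
have bmb : (b <= m * b)%N by rewrite leq_pmull.
(* [resultant_in_ideal] wants positive degree in y on both sides. A polynomial constant in y is its
   own eliminant; [a <= b] and [0 < m] make its degree fit the bound. *)
have [/size1_polyC fE|f1] := leqP (size f) 1.
  exists f`_0, 1, 0; split.
  - by apply: contraNneq f0 => f00; rewrite fE f00.
  - by rewrite mul1r mul0r addr0 -fE.
  - apply: (leq_trans (max_size_coefXY _ _)); apply: (leq_trans fa).
    by rewrite ltnS (leq_trans ab) // (leq_trans bmb) // leq_addl.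
have [/size1_polyC gE|g1] := leqP (size g) 1.
  exists g`_0, 0, 1; split.
  - by apply: contraNneq g0 => g00; rewrite gE g00.
  - by rewrite mul1r mul0r add0r -gE.
  - apply: (leq_trans (max_size_coefXY _ _)); apply: (leq_trans gb).
    by rewrite ltnS (leq_trans bmb) // leq_addl.
have [[u v] /= _ E] := resultant_in_ideal f1 g1.
exists (resultant f g), u, v; split => //.
apply: (leq_trans (size_resultant_leq fa gb)); rewrite ltnS leq_add // leq_mul //.
  by rewrite -subn1 leq_subLR add1n.
by rewrite -subn1 leq_subLR add1n.
Qed.

Lemma unit_const2 (e g : {poly {poly K}}) : e * g = 1 -> exists z : K, z != 0 /\ e = z%:P%:P.
Proof.
move=> eg.
have : size (e * g) == 1%N by rewrite eg size_poly1.
rewrite size_mul_eq1 => /andP[/size_poly1P [e1 e10 eE] /size_poly1P [g1 g10 gE]].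
have e1g1 : e1 * g1 = 1.
  by apply/polyC_inj; rewrite polyCM -eE -gE eg.
have : size (e1 * g1) == 1%N by rewrite e1g1 size_poly1.
rewrite size_mul_eq1 => /andP[/size_poly1P [z z0 zE] _].
by exists z; split=> //; rewrite eE zE.
Qed.

End Eliminant.

Lemma polyC2_mulKV (K : fieldType) (z : K) (c : {poly {poly K}}) : z != 0 ->
  (z^-1)%:P%:P * (z%:P%:P * c) = c.
Proof. by move=> z0; rewrite mulrA -!polyCM mulVf // !polyC1 mul1r. Qed.

Lemma polyC2_1D (K : idomainType) (z : K) (c : {poly {poly K}}) :
  (1 + z)%:P%:P * c = c + z%:P%:P * c.
Proof. by rewrite !polyCD mulrDl mul1r. Qed.

(** * Adjoints and self-adjoint common factors *)

Section Hermitian.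
Variable R : rcfType.
Local Notation C := R[i].
Local Notation conjp := (map_poly (@conjc R)).
Implicit Types (c e f g : {poly {poly C}}) (z : C).

(** At a point with y = [x^*] the adjoint takes the conjugate of the value of [c]. So a zero of [c]
    there is a common zero, and a self-adjoint [c] is real there. *)
Definition hadj c : {poly {poly C}} := map_poly (map_poly (@conjc R)) (swapXY c).

Lemma hadjM c e : hadj (c * e) = hadj c * hadj e.
Proof. by rewrite /hadj !rmorphM. Qed.

Lemma hadjD c e : hadj (c + e) = hadj c + hadj e.
Proof. by rewrite /hadj !rmorphD. Qed.

Lemma hadjC z : hadj z%:P%:P = (z^*)%:P%:P.
Proof. by rewrite /hadj swapXY_polyC !map_polyC /= map_polyC. Qed.

Lemma coef_hadj c i j : (hadj c)`_i`_j = (c`_j`_i)^*.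
Proof. by rewrite /hadj coef_map coef_map coef_swapXY. Qed.

Lemma hadjK : involutive hadj.
Proof. by move=> c; apply/polyP => i; apply/polyP => j; rewrite !coef_hadj conjcK. Qed.

Lemma hadj_eq0 c : (hadj c == 0) = (c == 0).
Proof.
have h0 : hadj 0 = 0 by rewrite /hadj !rmorph0.
by apply/eqP/eqP => [/(congr1 hadj)|->//]; rewrite hadjK h0.
Qed.

Lemma conjp_inj : injective conjp.
Proof. exact: map_poly_inj. Qed.

Lemma size_hadj c : size (hadj c) = sizeY c.
Proof. by rewrite /hadj size_map_inj_poly ?sizeYE ?rmorph0 //; exact: conjp_inj. Qed.

Lemma sizeY_hadj c : sizeY (hadj c) = size c.
Proof. by rewrite -size_hadj hadjK. Qed.

Lemma horner_hadj c (x y : C) : (hadj c).[x%:P].[y] = ((c.[(y^*)%:P]).[x^*])^*.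
Proof.
have -> : x%:P = conjp (x^*)%:P by rewrite map_polyC /= conjcK.
rewrite /hadj horner_map -[in LHS](conjcK y) horner_map /=.
by rewrite horner2_swapXY.
Qed.

Lemma inner_primitive_hadj c :
  (forall y : C, c.[y%:P] != 0) -> inner_primitive (hadj c).
Proof.
move=> cy x; rewrite -horner_swapXY /hadj swapXY_map swapXYK.
have -> : x%:P = conjp (x^*)%:P by rewrite map_polyC /= conjcK.
rewrite horner_map /=.
apply: contraNneq (cy x^*) => h; apply/eqP/conjp_inj.
by rewrite h rmorph0.
Qed.

(* Writing [f = c f1] and [hadj f = c g1] with [f1], [g1] coprime, Gauss's lemma
   shows that [c] and [hadj c] are associate, so that [c] can be rescaled to be
   real on the real points [(z^*, z)]. *)
Lemma hermitian_common_factor f m a : f != 0 ->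
  (forall y : C, f.[y%:P] != 0) ->
  (size f <= m.+1)%N -> (sizeY f <= a.+1)%N -> (a <= m)%N -> (0 < m)%N ->
  exists c f1 (r : {poly C}),
    [/\ hadj c = c, f = c * f1, r != 0, (size r <= (a * a + m * m).+1)%N &
        forall z, f1.[(z^*)%:P].[z] = 0 -> root r z].
Proof.
move=> f0 fy fm fa am m0.
have hf0 : hadj f != 0 by rewrite hadj_eq0.
have [c [f1 [g1 [fE gE r0]]]] := coprime_cofactors f0 hf0.
have c0 : c != 0 by apply: contraNneq f0 => c0; rewrite fE c0 mul0r.
have f10 : f1 != 0 by apply: contraNneq f0 => h; rewrite fE h mulr0.
have g10 : g1 != 0 by apply: contraNneq hf0 => h; rewrite gE h mulr0.
have sM (u v : {poly {poly C}}) : u != 0 -> v != 0 -> (size v <= size (u * v)%R)%N.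
  move=> u0 v0; rewrite size_mul // -subn1 -addnBAC ?size_poly_gt0 // leq_addl //.
have sYM (u v : {poly {poly C}}) : u != 0 -> v != 0 -> (sizeY v <= sizeY (u * v)%R)%N.
  move=> u0 v0; rewrite sizeY_mul // -subn1 -addnBAC ?leq_addl //.
  by rewrite sizeYE size_poly_gt0 swapXY_eq0.
have [r [u [v [rn0 rE rs]]]] : exists r u v,
    [/\ r != 0, r%:P = u * f1 + v * g1 & (size r <= (a * a + m * m).+1)%N].
  apply: (@eliminant _ f1 g1 m a a m) => //.
  - by apply: leq_trans fm; rewrite fE; apply: sM.
  - by apply: leq_trans fa; rewrite -size_hadj gE; apply: sM.
  - by apply: leq_trans fa; rewrite fE; apply: sYM.
  - by apply: leq_trans fm; rewrite -sizeY_hadj gE; apply: sYM.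
have hcP : inner_primitive (hadj c).
  apply: inner_primitive_hadj => y; apply: contraNneq (fy y) => cy.
  by rewrite fE hornerM cy mul0r.
(* Multiplied by [c], the identity [rE] reads r c = u f + v (adjoint of f), and [hadj c] divides
   both terms since the adjoint is an involution. Gauss's lemma then removes [r]. *)
have [e cE] : exists e, c = e * hadj c.
  apply: (@gauss_cancel _ r (hadj c) (u * hadj g1 + v * hadj f1) c rn0 hcP).
  have E1 : f = hadj c * hadj g1 by rewrite -hadjM -gE hadjK.
  have E2 : hadj f = hadj c * hadj f1 by rewrite -hadjM -fE.
  rewrite rE mulrDl [(u * hadj g1 + _) * _]mulrDl -!mulrA.
  by rewrite [f1 * c]mulrC [g1 * c]mulrC -fE -gE E2 E1 ![hadj c * _]mulrC.
have ee : e * hadj e = 1.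
  apply: (mulIf c0); rewrite mul1r [RHS]cE -mulrA; congr (_ * _).
  by rewrite {2}cE hadjM hadjK.
have [z [z0 ez]] := unit_const2 ee.
have hf1E : hadj f1 = z%:P%:P * g1.
  apply: (mulfI (_ : hadj c != 0)); first by rewrite hadj_eq0.
  by rewrite -hadjM -fE gE -ez mulrA [hadj c * _]mulrC -cE.
(* At a real point a zero of [f1] is a zero of [hadj f1], hence of its scalar multiple [g1], hence
   of the eliminant. *)
have common x : f1.[(x^*)%:P].[x] = 0 -> root r x.
  move=> f1x.
  have : (hadj f1).[(x^*)%:P].[x] = 0 by rewrite horner_hadj conjcK f1x rmorph0.
  rewrite hf1E hornerM !hornerC hornerM hornerC => /eqP; rewrite mulf_eq0 (negbTE z0) /= => /eqP g1x.
  have := congr1 (fun p : {poly {poly C}} => p.[(x^*)%:P].[x]) rE.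
  by rewrite hornerC hornerD !hornerM hornerD !hornerM f1x g1x !mulr0 addr0 /root => ->.
(* The sum of [c] and its adjoint is self-adjoint and equals (1 + 1/z) c. It vanishes when z = -1,
   where multiplication by i serves instead. *)
have [k [k0 hk]] : exists k : C, k != 0 /\ hadj (k%:P%:P * c) = k%:P%:P * c.
  have hc : z%:P%:P * hadj c = c by rewrite -ez -cE.
  have [zN1|zN1] := eqVneq z (-1).
    exists 'i; split; first by rewrite eq_complex /= oner_eq0 andbF.
    rewrite hadjM hadjC -[in RHS]hc mulrA -!polyCM zN1; congr (_%:P%:P * _).
    by rewrite mulrN1 /=; apply/eqP; rewrite eq_complex /= oppr0 !eqxx.
  exists (1 + z^-1); split.
    by apply: contra zN1; rewrite addrC addr_eq0 => /eqP h; rewrite -[z]invrK h invrN1.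
  have -> : (1 + z^-1)%:P%:P * c = c + hadj c.
    by rewrite polyC2_1D; congr (_ + _); apply/esym; rewrite -{2}hc polyC2_mulKV.
  by rewrite hadjD hadjK addrC.
exists (k%:P%:P * c), (k^-1%:P%:P * f1), r; split => //.
  by rewrite mulrCA -mulrA polyC2_mulKV.
move=> x; rewrite hornerM !hornerC hornerM hornerC => /eqP.
by rewrite mulf_eq0 invr_eq0 (negbTE k0) /= => /eqP; exact: common.
Qed.

End Hermitian.

(** * Second-order expansions *)

Section AsymptoticOrders.
Variable R : realType.
Local Notation C := R[i].
Implicit Types (u v f g : C -> C) (z c al be s : C).

Definition bigOh k u := exists2 M : C, 0 <= M & \forall h \near (0 : C), `|u h| <= M * `|h| ^+ k.
Definition littleoh2 u := forall eps : C, 0 < eps -> \forall h \near (0 : C), `|u h| <= eps * `|h| ^+ 2.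

Lemma near0_norm_lt (e : C) : 0 < e -> \forall h \near (0 : C), `|h| < e.
Proof.
by move=> e0; apply/nbhs_normP; exists e => //= h /=; rewrite sub0r normrN.
Qed.

Lemma bigOhD k u v : bigOh k u -> bigOh k v -> bigOh k (fun h => u h + v h).
Proof.
move=> [M M0 uM] [N N0 vN]; exists (M + N); first exact: addr_ge0.
near=> h; rewrite mulrDl (le_trans (ler_normD _ _)) // lerD //; near: h; [exact: uM|exact: vN].
Unshelve. all: by end_near. Qed.

Lemma bigOhM k l u v : bigOh k u -> bigOh l v -> bigOh (k + l) (fun h => u h * v h).
Proof.
move=> [M M0 uM] [N N0 vN]; exists (M * N); first exact: mulr_ge0.
near=> h; rewrite normrM exprD mulrACA ler_pM //; near: h; [exact: uM|exact: vN].
Unshelve. all: by end_near. Qed.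

Lemma bigOhW k l u : (l <= k)%N -> bigOh k u -> bigOh l u.
Proof.
move=> lk [M M0 uM]; exists M => //; near=> h.
have /le_trans-> // : `|u h| <= M * `|h| ^+ k by near: h; exact: uM.
have h1 : `|h| < 1 by near: h; exact: near0_norm_lt.
by rewrite ler_wpM2l // ler_wiXn2l // ltW.
Unshelve. all: by end_near. Qed.

Lemma bigOh_cst z : bigOh 0 (fun=> z).
Proof. by exists `|z| => //; near=> h; rewrite expr0 mulr1. Unshelve. all: by end_near. Qed.

Lemma bigOh_id : bigOh 1 (fun h => h).
Proof. by exists 1 => //; near=> h; rewrite mul1r. Unshelve. all: by end_near. Qed.

Lemma bigOh_conj : bigOh 1 (fun h => h^*).
Proof. by exists 1 => //; near=> h; rewrite mul1r normcJ. Unshelve. all: by end_near. Qed.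

Lemma bigOh3 u : bigOh 3 u -> littleoh2 u.
Proof.
move=> [M M0 uM] e e0; near=> h.
have /le_trans-> // : `|u h| <= M * `|h| ^+ 3 by near: h; exact: uM.
rewrite exprS mulrA ler_wpM2r ?exprn_ge0 //.
have hM : `|h| <= e / (M + 1).
  by apply/ltW; near: h; apply: near0_norm_lt; rewrite divr_gt0 // ltr_wpDl.
rewrite (le_trans (ler_wpM2l M0 hM)) // mulrCA ger_pMr //.
by rewrite ler_pdivrMr ?ltr_wpDl // mul1r lerDl.
Unshelve. all: by end_near. Qed.

Lemma littleoh2_bigOh u : littleoh2 u -> bigOh 2 u.
Proof. by move=> uo; exists 1 => //; exact: uo. Qed.

Lemma littleoh2D u v : littleoh2 u -> littleoh2 v -> littleoh2 (fun h => u h + v h).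
Proof.
move=> uo vo e e0; have e2 : 0 < e / 2 by rewrite divr_gt0.
near=> h; rewrite [e]splitr mulrDl (le_trans (ler_normD _ _)) // lerD //; near: h; [exact: uo|exact: vo].
Unshelve. all: by end_near. Qed.

Lemma littleoh2Ml u v : bigOh 0 u -> littleoh2 v -> littleoh2 (fun h => u h * v h).
Proof.
move=> [M M0 uM] vo e e0.
have e2 : 0 < e / (M + 1) by rewrite divr_gt0 // ltr_wpDl.
near=> h; rewrite normrM.
have hu : `|u h| <= M * `|h| ^+ 0 by near: h; exact: uM.
rewrite expr0 mulr1 in hu.
have hv : `|v h| <= e / (M + 1) * `|h| ^+ 2 by near: h; exact: vo.
rewrite (le_trans (ler_pM _ _ hu hv)) // mulrA ler_wpM2r ?exprn_ge0 // mulrCA ger_pMr //.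
by rewrite ler_pdivrMr ?ltr_wpDl // mul1r lerDl.
Unshelve. all: by end_near. Qed.

Lemma littleoh2_comp u v : bigOh 1 v -> littleoh2 u -> littleoh2 (fun h => u (v h)).
Proof.
move=> [M M0 vM] uo e e0.
have M1 : 0 < M + 1 by rewrite ltr_wpDl.
have e2 : 0 < e / (M + 1) ^+ 2 by rewrite divr_gt0 // exprn_gt0.
have [d /= d0 ud] := (nbhs_normP _ _).1 (uo _ e2).
near=> h.
have hv : `|v h| <= M * `|h| ^+ 1 by near: h; exact: vM.
rewrite expr1 in hv.
have hd : `|h| < d / (M + 1) by near: h; apply: near0_norm_lt; rewrite divr_gt0.
have vd : `|v h| < d.
  apply: (le_lt_trans hv); apply: (@le_lt_trans _ _ ((M + 1) * `|h|)).
    by rewrite ler_wpM2r // lerDl.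
  by rewrite mulrC -ltr_pdivlMr.
have /le_trans-> // : `|u (v h)| <= e / (M + 1) ^+ 2 * `|v h| ^+ 2.
  by apply: ud; rewrite /= sub0r normrN.
rewrite -mulrA ler_pM2l // mulrC ler_pdivrMr ?exprn_gt0 // mulrC -exprMn.
rewrite ler_pXn2r ?nnegrE ?mulr_ge0 //.
  by rewrite (le_trans hv) // ler_wpM2r // lerDl.
by rewrite ltW.
Unshelve. all: by end_near. Qed.

End AsymptoticOrders.

Section Jets.
Variable R : realType.
Local Notation C := R[i].
Implicit Types (u v f g : C -> C) (z c al be a b s : C).

(* [al], [be] and [s] are the Wirtinger derivatives of [g] at [z] with respect to h,
   conj h, and both; the Laplacian at [z] is [4 s]. *)
Definition jet g z c al be a b s := littleoh2 (fun h =>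
  g (z + h) - (c + (al * h + be * h^*) + (a * h ^+ 2 + b * h^* ^+ 2 + s * (h * h^*)))).

Lemma bigOh_linear al be : bigOh 1 (fun h : C => al * h + be * h^*).
Proof.
apply: bigOhD; rewrite -[1%N]add0n; apply: bigOhM;
  [exact: bigOh_cst|exact: bigOh_id|exact: bigOh_cst|exact: bigOh_conj].
Qed.

Lemma bigOh_quadratic a b s :
  bigOh 2 (fun h : C => a * h ^+ 2 + b * h^* ^+ 2 + s * (h * h^*)).
Proof.
have id := @bigOh_id R; have cj := @bigOh_conj R.
apply: bigOhD; first apply: bigOhD.
all: rewrite -[2%N]add0n; apply: bigOhM; first exact: bigOh_cst.
all: exact: (@bigOhM R 1 1).
Qed.

Lemma littleoh2_eq u v : u =1 v -> littleoh2 u -> littleoh2 v.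
Proof. by move=> /funext ->. Qed.

Lemma jet_value g z c al be a b s : jet g z c al be a b s -> g z = c.
Proof.
move=> /(_ 1 ltr01) /nbhs_singleton.
rewrite conjc0 normr0 !expr0n !mulr0 !addr0 normr_le0 subr_eq0.
by move=> /eqP.
Qed.

Lemma jet_near_eq f g z c al be a b s : (\forall h \near (0 : C), f (z + h) = g (z + h)) ->
  jet f z c al be a b s -> jet g z c al be a b s.
Proof.
move=> fg fj e e0; near=> h; have <- : f (z + h) = g (z + h) by near: h.
by near: h; exact: fj.
Unshelve. all: by end_near. Qed.

Lemma jetD f g z c al be a b s c' al' be' a' b' s' :
  jet f z c al be a b s -> jet g z c' al' be' a' b' s' ->
  jet (fun x => f x + g x) z (c + c') (al + al') (be + be') (a + a') (b + b') (s + s').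
Proof.
move=> fj gj; apply: littleoh2_eq (littleoh2D fj gj) => h /=; ring.
Qed.

Lemma littleoh2_0 : littleoh2 (fun=> 0 : C).
Proof.
by move=> e e0; near=> h; rewrite normr0 mulr_ge0 ?exprn_ge0 // ltW.
Unshelve. all: by end_near. Qed.

Lemma jet_cst z c : jet (fun=> c) z c 0 0 0 0 0.
Proof. by apply: littleoh2_eq littleoh2_0 => h; rewrite !mul0r !addr0 subrr. Qed.

Lemma jet_id z : jet id z z 1 0 0 0 0.
Proof. by apply: littleoh2_eq littleoh2_0 => h; rewrite !mul0r !addr0 mul1r subrr. Qed.

Lemma jet_conj g z c al be a b s : jet g z c al be a b s ->
  jet (fun x => (g x)^*) z c^* be^* al^* b^* a^* s^*.
Proof.
move=> gj e e0; near=> h.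
set E := (X in `|X| <= _).
have -> : E = (g (z + h) - (c + (al * h + be * h^*) +
    (a * h ^+ 2 + b * h^* ^+ 2 + s * (h * h^*))))^*.
  rewrite /E !(rmorphB, rmorphD, rmorphM, rmorphXn) /= !conjcK; ring.
by rewrite normcJ; near: h; exact: gj.
Unshelve. all: by end_near. Qed.

Lemma jet_bigOh g z c al be a b s : jet g z c al be a b s ->
  bigOh 1 (fun h => g (z + h) - c).
Proof.
move=> gj.
have O1 := bigOhD (bigOh_linear al be) (bigOhW (leqnSn 1)
  (bigOhD (bigOh_quadratic a b s) (littleoh2_bigOh gj))).
case: O1 => M M0 H; exists M => //; near=> h.
have -> : g (z + h) - c = (al * h + be * h^* +
   ((a * h ^+ 2 + b * h^* ^+ 2 + s * (h * h^*)) +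
      (g (z + h) - (c + (al * h + be * h^*) +
          (a * h ^+ 2 + b * h^* ^+ 2 + s * (h * h^*)))))) by ring.
by near: h; exact: H.
Unshelve. all: by end_near. Qed.

Lemma jet_bounded g z c al be a b s : jet g z c al be a b s ->
  bigOh 0 (fun h => g (z + h)).
Proof.
move=> /jet_bigOh /(bigOhW (leq0n 1)) /bigOhD /(_ (bigOh_cst c)) [M M0 H].
by exists M => //; near=> h; rewrite -[g _](subrK c); near: h; exact: H.
Unshelve. all: by end_near. Qed.

Lemma jetM f g z c al be a b s c' al' be' a' b' s' :
  jet f z c al be a b s -> jet g z c' al' be' a' b' s' ->
  jet (fun x => f x * g x) z (c * c') (c * al' + al * c') (c * be' + be * c')
    (c * a' + a * c' + al * al') (c * b' + b * c' + be * be')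
    (c * s' + s * c' + (al * be' + be * al')).
Proof.
move=> fj gj.
pose L h := al * h + be * h^*; pose L' h := al' * h + be' * h^*.
pose N h := a * h ^+ 2 + b * h^* ^+ 2 + s * (h * h^*).
pose N' h := a' * h ^+ 2 + b' * h^* ^+ 2 + s' * (h * h^*).
have L1 : bigOh 1 L by exact: bigOh_linear.
have L1' : bigOh 1 L' by exact: bigOh_linear.
have N2 : bigOh 2 N by exact: bigOh_quadratic.
have N2' : bigOh 2 N' by exact: bigOh_quadratic.
have fb := jet_bounded fj.
have P'b : bigOh 0 (fun h => c' + (L' h + N' h)).
  apply: bigOhD; first exact: bigOh_cst.
  by apply: bigOhD; [apply: bigOhW L1'|apply: bigOhW N2'].
(* The error splits into f times the error of g, the expansion of g times the error of f, and
   products [T3] to [T5] of total order at least 3. *)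
have T1 := littleoh2Ml fb gj.
have T2 := littleoh2Ml P'b fj.
have T3 : littleoh2 (fun h => L h * N' h) by apply: bigOh3; exact: (bigOhM L1 N2').
have T4 : littleoh2 (fun h => L' h * N h) by apply: bigOh3; exact: (bigOhM L1' N2).
have T5 : littleoh2 (fun h => N h * N' h).
  by apply/bigOh3/(@bigOhW _ 4) => //; exact: (bigOhM N2 N2').
apply: littleoh2_eq (littleoh2D (littleoh2D (littleoh2D (littleoh2D T1 T2) T3) T4) T5) => h.
by rewrite /L /L' /N /N'; ring.
Qed.

Lemma jet_poly (p : {poly C}) z :
  exists a, jet (horner p) z p.[z] p^`().[z] 0 a 0 0.
Proof.
elim/poly_ind: p => [|p c [a IH]].
  exists 0; rewrite deriv0 horner0.
  have -> : horner (0 : {poly C}) = fun=> 0 by apply/funext => x; exact: horner0.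
  exact: jet_cst.
have J := jetD (jetM IH (jet_id z)) (jet_cst z c).
exists (p.[z] * 0 + a * z + p^`().[z] * 1 + 0).
have -> : horner (p * 'X + c%:P) = fun x => p.[x] * x + c.
  by apply/funext => x; exact: hornerMXaddC.
have -> : (p * 'X + c%:P)^`().[z] = p.[z] * 1 + p^`().[z] * z + 0.
  by rewrite derivD derivM derivX derivC addr0 hornerD !hornerM hornerX hornerC addr0 addrC.
by move: J; rewrite !(mulr0, mul0r, addr0).
Qed.

End Jets.

(** * Inverses, composition and local maxima of expansions *)

Section JetCalculus.
Variable R : realType.
Local Notation C := R[i].
Implicit Types (u v f g : C -> C) (z c al be a b s : C).

Lemma jet_away0 g z c al be a b s : c != 0 -> jet g z c al be a b s ->
  \forall h \near (0 : C), `|c| / 2 <= `|g (z + h)|.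
Proof.
move=> c0 /jet_bigOh [M M0 gM].
have nc : 0 < `|c| by rewrite normr_gt0.
have M1 : 0 < M + 1 by rewrite ltr_wpDl.
near=> h.
have hg : `|g (z + h) - c| <= M * `|h| ^+ 1 by near: h; exact: gM.
have hh : `|h| < `|c| / (2 * (M + 1)).
  by near: h; apply: near0_norm_lt; rewrite divr_gt0 // mulr_gt0.
have h2 : `|g (z + h) - c| <= `|c| / 2.
  apply: (le_trans hg); apply: (@le_trans _ _ ((M + 1) * `|h|)).
    by rewrite expr1 ler_wpM2r // lerDl.
  by rewrite -ler_pdivlMl // ltW // (lt_le_trans hh) // invfM mulrA [_^-1 * (_ / _)]mulrC.
have := lerB_normD c (g (z + h) - c).
have -> : c + (g (z + h) - c) = g (z + h) by rewrite addrC subrK.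
apply: le_trans.
by rewrite lerBrDr (le_trans (lerD (lexx _) h2)) // -splitr.
Unshelve. all: by end_near. Qed.

(** The candidate expansion [T] satisfies g T = 1 + o(|h|^2) by the product rule; multiplying by
    1/g, bounded near [z], gives the claim. *)
Lemma jetV g z c al be a b s : c != 0 -> jet g z c al be a b s ->
  jet (fun x => (g x)^-1) z c^-1 (- al / c ^+ 2) (- be / c ^+ 2)
    (- a / c ^+ 2 + al ^+ 2 / c ^+ 3) (- b / c ^+ 2 + be ^+ 2 / c ^+ 3)
    (- s / c ^+ 2 + 2 * (al * be) / c ^+ 3).
Proof.
move=> c0 gj.
pose T h := c^-1 + ((- al / c ^+ 2) * h + (- be / c ^+ 2) * h^*) +
   ((- a / c ^+ 2 + al ^+ 2 / c ^+ 3) * h ^+ 2 + (- b / c ^+ 2 + be ^+ 2 / c ^+ 3) * h^* ^+ 2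
    + (- s / c ^+ 2 + 2 * (al * be) / c ^+ 3) * (h * h^*)).
have zh h : z + h - z = h by rewrite addrC addKr.
have Tj : jet (fun x => T (x - z)) z c^-1 (- al / c ^+ 2) (- be / c ^+ 2)
    (- a / c ^+ 2 + al ^+ 2 / c ^+ 3) (- b / c ^+ 2 + be ^+ 2 / c ^+ 3)
    (- s / c ^+ 2 + 2 * (al * be) / c ^+ 3).
  apply: littleoh2_eq (@littleoh2_0 R) => h.
  by cbv beta; rewrite zh /T addrA subrr.
have E1 : littleoh2 (fun h => 1 - g (z + h) * T h).
  apply: littleoh2_eq (littleoh2Ml (bigOh_cst (-1)) (jetM gj Tj)) => h.
  cbv beta; rewrite zh.
  by field.
have away := jet_away0 c0 gj.
have nc : 0 < `|c| by rewrite normr_gt0.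
have gV : bigOh 0 (fun h => (g (z + h))^-1).
  exists (2 / `|c|); first by rewrite divr_ge0.
  near=> h; rewrite expr0 mulr1 normfV.
  have lb : `|c| / 2 <= `|g (z + h)| by near: h.
  by rewrite -[2 / _]invf_div lef_pV2 // posrE ?(lt_le_trans _ lb) // divr_gt0.
move=> e e0; near=> h.
have g0 : g (z + h) != 0.
  rewrite -normr_gt0; apply: (@lt_le_trans _ _ (`|c| / 2)); first by rewrite divr_gt0.
  by near: h.
rewrite -/(T h).
have -> : (g (z + h))^-1 - T h = (g (z + h))^-1 * (1 - g (z + h) * T h).
  by rewrite mulrBr mulr1 mulKf.
near: h; exact: (littleoh2Ml gV E1).
Unshelve. all: by end_near. Qed.

Lemma jet_perturb f g z c al be a b s : jet g z c al be a b s ->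
  littleoh2 (fun h => f (z + h) - g (z + h)) -> jet f z c al be a b s.
Proof.
move=> gj fg; apply: littleoh2_eq (littleoh2D fg gj) => h.
by rewrite addrA subrK.
Qed.

(** The zero coefficients of [g] say that it is holomorphic to second order. The mixed coefficient
    is then just multiplied by |al'|^2: the conformal rule for the Laplacian. *)
Lemma jet_comp_hol f g z w c al be a b s al' a' :
  jet f w c al be a b s -> jet g z w al' 0 a' 0 0 ->
  exists a2 b2, jet (f \o g) z c (al * al') (be * al'^*) a2 b2 (s * (al' * al'^*)).
Proof.
move=> fj gj.
have kj : jet (fun x => g x + - w) z 0 al' 0 a' 0 0.
  by have := jetD gj (jet_cst z (- w)); rewrite subrr !addr0.
have kj' := jet_conj kj.
have J := jetD (jet_cst z c) (jetD (jetD (jetM (jet_cst z al) kj) (jetM (jet_cst z be) kj'))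
  (jetD (jetD (jetM (jet_cst z a) (jetM kj kj)) (jetM (jet_cst z b) (jetM kj' kj')))
    (jetM (jet_cst z s) (jetM kj kj')))).
set Pk := (X in jet X) in J.
have Eo : littleoh2 (fun h => f (g (z + h)) - Pk (z + h)).
  have := littleoh2_comp (jet_bigOh gj) fj; apply: littleoh2_eq => h.
  rewrite /Pk; have -> : w + (g (z + h) - w) = g (z + h) by rewrite addrC subrK.
  by congr (_ - _); ring.
have := jet_perturb (f := f \o g) J Eo; rewrite conjc0 !(mulr0, mul0r, addr0, add0r).
by move=> J'; eexists; eexists; exact: J'.
Qed.

(** In a direction [u] of modulus 1 the linear form scales like e while the rest is O(e^2), so it
    vanishes; the directions 1 and i separate [al] from [be]. *)
Lemma jet0_linear z al be a b s : jet (fun=> 0) z 0 al be a b s -> al = 0.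
Proof.
move=> J0.
have O2 := bigOhD (bigOh_quadratic a b s) (littleoh2_bigOh J0).
case: O2 => M M0 /nbhs_normP [d /= d0 H].
have {}H h : `|h| < d -> `|al * h + be * h^*| <= M * `|h| ^+ 2.
  move=> hd; have := H h; rewrite /= sub0r normrN => /(_ hd); congr (_ <= _).
  rewrite -normrN; congr (`|_|); ring.
have M1 : 0 < M + 1 by rewrite ltr_wpDl.
have key (u : C) : `|u| = 1 -> al * u + be * u^* = 0.
  move=> u1; apply/eqP; rewrite -normr_le0 -[_ <= 0]negbK -real_ltNge ?real0 ?normr_real //.
  apply/negP => y0; set y := `|_| in y0.
  pose e := y / (y / d + (M + 1)).
  have yd : 0 < y / d by rewrite divr_gt0.
  have S0 : 0 < y / d + (M + 1) by apply: addr_gt0.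
  have e0 : 0 < e by rewrite divr_gt0.
  have ed : e < d.
    rewrite /e ltr_pdivrMr // mulrDr [d * (y / d)]mulrC divfK ?gt_eqF //.
    by rewrite ltrDl mulr_gt0.
  have ne : `|e * u| = e by rewrite normrM u1 mulr1 gtr0_norm.
  have := H (e * u); rewrite ne => /(_ ed).
  have ec : e^* = e by apply/CrealP; rewrite realE ltW.
  have -> : al * (e * u) + be * (e * u)^* = e * (al * u + be * u^*).
    by rewrite rmorphM /= ec; ring.
  rewrite normrM gtr0_norm // -/y expr2 mulrCA ler_pM2l // => yM.
  have : M * e < y.
    rewrite /e mulrA ltr_pdivrMr // mulrC ltr_pM2l //.
    by rewrite addrA ltr_pwDr // ler_wpDl // ltW.
  by move=> /(le_lt_trans yM); rewrite ltxx.
have := key 1 (normr1 _); rewrite conjc1 !mulr1 => k1.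
have ni : `|'i : C| = 1 by rewrite normc_def /= expr0n expr1n add0r sqrtr1.
have := key 'i ni.
have -> : 'i^* = - 'i :> C by apply/eqP; rewrite eq_complex /= oppr0 !eqxx.
rewrite mulrN -mulrBl => /eqP; rewrite mulf_eq0 => /orP[|]; last first.
  by rewrite eq_complex /= oner_eq0 andbF.
move=> /eqP k2.
have : al + be + (al - be) = 0 by rewrite k1 k2 addr0.
rewrite addrACA subrr addr0 -mulr2n => /eqP; rewrite mulrn_eq0 /= => /eqP.
by [].
Qed.

Lemma local_max_jet g z c al be a b s : jet g z c al be a b s ->
  (\forall h \near (0 : C), complex.Re (g (z + h)) <= complex.Re (g z)) ->
  complex.Re s <= 0.
Proof.
move=> gj gm; rewrite leNgt; apply/negP => s0.
have gz := jet_value gj.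
(* Over the four points t, -t, it, -it the linear terms and those in h^2 and its conjugate cancel,
   which leaves 4 Re s r^2. Four errors of at most (Re s / 2) r^2 make up only half of that. *)
have e0 : 0 < (complex.Re s / 2)%:C by rewrite ltcR divr_gt0.
have /nbhs_normP [d /= d0 H] : \forall h \near (0 : C),
    complex.Re (g (z + h)) <= complex.Re (g z) /\
    `|g (z + h) - (c + (al * h + be * h^*) + (a * h ^+ 2 + b * h^* ^+ 2 + s * (h * h^*)))|
      <= (complex.Re s / 2)%:C * `|h| ^+ 2.
  by apply: filterI; [exact: gm|exact: gj].
have dr := RRe_real (gtr0_real d0).
have r0 : 0 < complex.Re d by rewrite -ltcR dr.
pose r := complex.Re d / 2; pose t : C := r%:C.
have rp : 0 < r by rewrite divr_gt0.
have t0 : 0 < t by rewrite ltcR.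
have td : t < d by rewrite -dr ltcR ltr_pdivrMr // ltr_pMr // ltr1n.
have tc : t^* = t by rewrite conjc_real.
pose Q (h : C) := a * h ^+ 2 + b * h^* ^+ 2 + s * (h * h^*).
pose T (h : C) := c + (al * h + be * h^*) + Q h.
have key h : `|h| = t -> complex.Re (T h) - complex.Re c <= complex.Re s / 2 * r ^+ 2.
  move=> ht.
  have hb : ball_ Num.norm (0 : C) d h by rewrite /ball_ /= sub0r normrN ht.
  case: (H h hb); rewrite gz -/(Q h) -/(T h) ht => h1 h2.
  apply: (@le_trans _ _ (complex.Re (T h) - complex.Re (g (z + h)))).
    by rewrite lerB.
  have h3 : (complex.Re (T h) - complex.Re (g (z + h)))%:C <= `|g (z + h) - T h|.
    rewrite distrC; apply: le_trans (normc_ge_Re _); rewrite lecR.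
    have -> : complex.Re (T h - g (z + h)) = complex.Re (T h) - complex.Re (g (z + h)).
      by case: (T h) => ? ?; case: (g _).
    exact: ler_norm.
  by rewrite -lecR rmorphM rmorphXn; exact: le_trans h3 h2.
have TT h : T h + T (- h) = 2 * c + 2 * Q h.
  by rewrite /T /Q rmorphN /=; ring.
have ic : 'i^* = - 'i :> C by apply/eqP; rewrite eq_complex /= oppr0 !eqxx.
have ii : 'i * 'i = -1 :> C by rewrite -expr2 sqr_i.
have QQ : Q t + Q ('i * t) = 2 * s * t ^+ 2.
  have cit : ('i * t)^* = - 'i * t by rewrite [LHS]rmorphM; congr (_ * _); [exact: ic|exact: tc].
  rewrite /Q cit tc.
  have -> : ('i * t) ^+ 2 = - t ^+ 2 by rewrite exprMn sqr_i mulN1r.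
  have -> : (- 'i * t) ^+ 2 = - t ^+ 2 by rewrite exprMn sqrrN sqr_i mulN1r.
  have -> : 'i * t * (- 'i * t) = t ^+ 2.
    by rewrite mulrACA mulrN ii opprK mul1r expr2.
  by ring.
have S : T t + T (- t) + (T ('i * t) + T (- ('i * t))) = 4 * c + 4 * (s * t ^+ 2).
  by rewrite !TT addrACA -[2 * Q t + _]mulrDr QQ; ring.
have nt : `|t| = t by rewrite gtr0_norm.
have ni : `|'i * t| = t by rewrite normrM nt normc_def /= expr0n expr1n add0r sqrtr1 mul1r.
have k1 := key t nt.
have k2 := key (- t); rewrite normrN in k2; have {}k2 := k2 nt.
have k3 := key ('i * t) ni.
have k4 := key (- ('i * t)); rewrite normrN in k4; have {}k4 := k4 ni.
move: k1 k2 k3 k4 S.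
move: (T t) (T (- t)) (T ('i * t)) (T (- ('i * t))) => A1 A2 A3 A4 k1 k2 k3 k4 S.
have := congr1 (@complex.Re R) S.
have ReD (x y : C) : complex.Re (x + y) = complex.Re x + complex.Re y.
  by case: x => ? ?; case: y.
have Re4 (x : C) : complex.Re (4 * x) = 4 * complex.Re x.
  by rewrite !mulr_natl; case: x => x1 x2; rewrite !mulrS !mulr0n.
have Rest : complex.Re (s * t ^+ 2) = complex.Re s * r ^+ 2.
  by rewrite /t -rmorphXn /=; case: (s) => s1 s2 /=; rewrite mulr0 subr0.
rewrite !ReD !Re4 Rest => E.
have r2 : 0 < complex.Re s * r ^+ 2 by rewrite mulr_gt0 // exprn_gt0.
lra.
Qed.

End JetCalculus.

(** * Taylor expansion of functions of class C^2 *)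

Section Taylor.
Variable R : realType.
Local Notation C := R[i].

Lemma mvt_bound (F : R -> R) (a b M : R) :
  (forall t, `|t - a| <= `|b - a| -> derivable F t 1 /\ `|derive1 F t| <= M) ->
  `|F b - F a| <= M * `|b - a|.
Proof.
have key (x y : R) : x <= y ->
  (forall t, x <= t <= y -> derivable F t 1 /\ `|derive1 F t| <= M) ->
  `|F y - F x| <= M * `|y - x|.
  move=> xy H.
  have [||c] := @MVT_segment R F (derive1 F) x y xy.
  - move=> t; rewrite in_itv /= => /andP[xt ty]; rewrite derive1E; apply/derivableP.
    by have [] := H t; rewrite ?(ltW xt) ?(ltW ty).
  - apply: derivable_within_continuous => t; rewrite in_itv /= => xty.
    by have [] := H t.
  rewrite in_itv /= => cxy ->; rewrite normrM ler_wpM2r //.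
  by case: (H c cxy).
move=> H; have [ab|ba] := leP a b.
  apply: key => // t /andP[at_ tb]; apply: H.
  by rewrite !ger0_norm ?subr_ge0 // lerD2r.
rewrite distrC [`|b - a|]distrC; apply: key => [|t /andP[bt ta]]; first exact: ltW.
apply: H.
have -> : `|t - a| = a - t by rewrite distrC ger0_norm ?subr_ge0.
have -> : `|b - a| = a - b by rewrite distrC ger0_norm ?subr_ge0 // ltW.
by rewrite lerD2l lerN2.
Qed.

Lemma mvt_bound_poly (F : R -> R) (q : {poly R}) (a b M : R) :
  (forall t, `|t - a| <= `|b - a| ->
     derivable F t 1 /\ `|derive1 F t - (deriv q).[t]| <= M) ->
  `|F b - F a - (q.[b] - q.[a])| <= M * `|b - a|.
Proof.
move=> H; rewrite [X in `|X|](_ : _ = (F b - q.[b]) - (F a - q.[a])); last by ring.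
apply: (@mvt_bound (fun t => F t - q.[t])) => t /H [Ft FM].
have DF : is_derive t (1 : R) F (derive1 F t) by rewrite derive1E; apply/derivableP.
have : is_derive t (1 : R) (fun t => F t - q.[t]) (derive1 F t - (deriv q).[t]).
  exact: is_deriveB.
by case=> ? E; rewrite derive1E E.
Qed.

Lemma norm_ReE (h : C) : `|h| = (complex.Re `|h|)%:C.
Proof. by rewrite RRe_real ?normr_real. Qed.

Lemma near0_radius (P : C -> Prop) : (\forall h \near (0 : C), P h) ->
  exists2 d : R, 0 < d & forall h, complex.Re `|h| < d -> P h.
Proof.
move=> /nbhs_normP [d /= d0 H].
have dr := RRe_real (gtr0_real d0).
exists (complex.Re d); first by rewrite -ltcR dr.
by move=> h hd; apply: H; rewrite /ball_ /= sub0r normrN norm_ReE -dr ltcR.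
Qed.

Lemma radius_near0 (P : C -> Prop) (d : R) : 0 < d ->
  (forall h, complex.Re `|h| < d -> P h) -> \forall h \near (0 : C), P h.
Proof.
move=> d0 H; apply/nbhs_normP; exists d%:C; first by rewrite /= ltcR.
by move=> h /=; rewrite sub0r normrN norm_ReE ltcR => /H.
Qed.

Lemma abs_Re_le (h : C) : `|complex.Re h| <= complex.Re `|h|.
Proof. by rewrite -lecR -norm_ReE normc_ge_Re. Qed.

Lemma Re_norm_mono (a b a' b' : R) : `|a| <= `|a'| -> `|b| <= `|b'| ->
  complex.Re `|a +i* b| <= complex.Re `|a' +i* b'|.
Proof.
have sq (u w : R) : `|u| <= `|w| -> u ^+ 2 <= w ^+ 2.
  by move=> uw; rewrite -(real_normK (num_real u)) -(real_normK (num_real w)) lerXn2r ?nnegrE.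
move=> aa bb; rewrite !normc_def /= ler_sqrt; first by rewrite lerD // sq.
by rewrite addr_ge0 ?sqr_ge0.
Qed.

Lemma abs_Im_le (h : C) : `|complex.Im h| <= complex.Re `|h|.
Proof.
case: h => a b /=; have := @Re_norm_mono 0 b a b.
by rewrite normr0 => /(_ (normr_ge0 _) (lexx _)); rewrite normc_def /= expr0n add0r sqrtr_sqr.
Qed.

Lemma continuous_near0 (g : C -> R) (z : C) : {for z, continuous g} ->
  forall eps : R, 0 < eps -> \forall h \near (0 : C), `|g (z + h) - g z| <= eps.
Proof.
move=> gc eps e0; apply: (nbhs0P (fun x => `|g x - g z| <= eps) z).1.
have /cvgrPdist_le /(_ _ e0) := gc => H.
near=> x; rewrite distrC; near: x; exact: H.
Unshelve. all: by end_near. Qed.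

(** Mean value theorem along a vertical segment from [z], then along a horizontal one; on both the
    distance to [z] never exceeds |h|. *)
Lemma first_order (g : C -> R) (z : C) :
  (\forall h \near (0 : C), has_partials g (z + h)) ->
  {for z, continuous (partial_x g)} -> {for z, continuous (partial_y g)} ->
  forall eps : R, 0 < eps -> \forall h \near (0 : C),
   `|g (z + h) - g z - (partial_x g z * complex.Re h + partial_y g z * complex.Im h)|
     <= eps * complex.Re `|h|.
Proof.
move=> gp cx cy eps e0; have e2 : 0 < eps / 2 by rewrite divr_gt0.
have /near0_radius [d d0 H] : \forall h \near (0 : C), has_partials g (z + h) /\
   (`|partial_x g (z + h) - partial_x g z| <= eps / 2 /\
    `|partial_y g (z + h) - partial_y g z| <= eps / 2).
  by apply: filterI gp _; apply: filterI; exact: continuous_near0.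
apply: (radius_near0 d0) => h hd.
case: z H {gp cx cy} => x y; case: h hd => p q hd H.
set gx := partial_x g _ in H *; set gy := partial_y g _ in H *.
have Bx : `|g ((x + p) +i* (y + q)) - g (x +i* (y + q)) - gx * p| <= eps / 2 * `|p|.
  have := @mvt_bound_poly (fun t => g (t +i* (y + q))) (gx *: 'X) x (x + p) (eps / 2).
  rewrite !hornerZ !hornerX -mulrBr [x + p]addrC addrK; apply => t tx.
  have := H ((t - x) +i* q); have -> : (x +i* y) + ((t - x) +i* q) = t +i* (y + q).
    by apply/eqP; rewrite eq_complex /= addrC subrK !eqxx.
  case; first by rewrite (le_lt_trans _ hd) // Re_norm_mono.
  move=> [tx' _] [tx'' _]; split; first exact: tx'.
  by rewrite derivZ derivX hornerZ hornerC mulr1; exact: tx''.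
have By : `|g (x +i* (y + q)) - g (x +i* y) - gy * q| <= eps / 2 * `|q|.
  have := @mvt_bound_poly (fun t => g (x +i* t)) (gy *: 'X) y (y + q) (eps / 2).
  rewrite !hornerZ !hornerX -mulrBr [y + q]addrC addrK; apply => t tx.
  have := H (0 +i* (t - y)); have -> : (x +i* y) + (0 +i* (t - y)) = x +i* t.
    by apply/eqP; rewrite eq_complex /= addr0 addrC subrK !eqxx.
  case; first by rewrite (le_lt_trans _ hd) // Re_norm_mono // normr0.
  move=> [_ tx'] [_ tx'']; split; first exact: tx'.
  by rewrite derivZ derivX hornerZ hornerC mulr1; exact: tx''.
have -> : (x +i* y) + (p +i* q) = (x + p) +i* (y + q) by [].
set N := complex.Re `|p +i* q|; rewrite /=.
have -> : g ((x + p) +i* (y + q)) - g (x +i* y) - (gx * p + gy * q) =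
  (g ((x + p) +i* (y + q)) - g (x +i* (y + q)) - gx * p) +
  (g (x +i* (y + q)) - g (x +i* y) - gy * q) by ring.
apply: (le_trans (ler_normD _ _)); apply: (le_trans (lerD Bx By)).
have := abs_Re_le (p +i* q); have := abs_Im_le (p +i* q); rewrite -/N /= => hq hp.
have -> : eps * N = eps / 2 * N + eps / 2 * N by rewrite -mulrDl -splitr.
by rewrite lerD // ler_wpM2l // ltW.
Qed.

Lemma quadratic_horner_diff (u w x p : R) :
  (u *: 'X + w *: (('X - x%:P) ^+ 2)).[x + p] - (u *: 'X + w *: (('X - x%:P) ^+ 2)).[x]
  = u * p + w * p ^+ 2.
Proof. by rewrite !hornerD !hornerZ !hornerX !horner_exp !hornerXsubC; ring. Qed.

Lemma quadratic_deriv (u w x t : R) :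
  (deriv (u *: 'X + w *: (('X - x%:P) ^+ 2))).[t] = u + 2 * w * (t - x).
Proof.
rewrite derivD !derivZ derivX expr2 derivM derivB derivX derivC subr0 mul1r mulr1.
by rewrite hornerD !hornerZ hornerD hornerXsubC hornerC; ring.
Qed.

(** The same two segments, after subtracting a quadratic polynomial on each, the first partials
    being controlled by [first_order]. The mixed term arises on the horizontal segment only, where
    the x-derivative is taken at height y + q. *)
Lemma second_order (v : C -> R) (z : C) (U : set C) : open U -> U z -> class_C 2 U v ->
  forall eps : R, 0 < eps -> \forall h \near (0 : C),
   `|v (z + h) - (v z + (partial_x v z * complex.Re h + partial_y v z * complex.Im h)
      + (partial_x (partial_x v) z / 2 * complex.Re h ^+ 2
         + partial_y (partial_x v) z * (complex.Re h * complex.Im h)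
         + partial_y (partial_y v) z / 2 * complex.Im h ^+ 2))|
     <= eps * complex.Re `|h| ^+ 2.
Proof.
move=> Uo Uz [vp [vxp vxx vxy] [vyp vyx vyy]] eps e0.
have e2 : 0 < eps / 2 by rewrite divr_gt0.
have Unear : \forall h \near (0 : C), U (z + h).
  by apply: (nbhs0P U z).1; exact: open_nbhs_nbhs.
have pnear g : (forall w, U w -> has_partials g w) -> \forall h \near (0 : C), has_partials g (z + h).
  by move=> gp; near=> h; apply: gp; near: h; exact: Unear.
have fx := first_order (pnear _ vxp) (vxx z Uz) (vxy z Uz) e2.
have fy := first_order (pnear _ vyp) (vyx z Uz) (vyy z Uz) e2.
have /near0_radius [d d0 H] : \forall h \near (0 : C), has_partials v (z + h) /\
   (`|partial_x v (z + h) - partial_x v z - (partial_x (partial_x v) z * complex.Re h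
        + partial_y (partial_x v) z * complex.Im h)| <= eps / 2 * complex.Re `|h| /\
    `|partial_y v (z + h) - partial_y v z - (partial_x (partial_y v) z * complex.Re h
        + partial_y (partial_y v) z * complex.Im h)| <= eps / 2 * complex.Re `|h|).
  by apply: filterI (pnear _ vp) _; exact: filterI fx fy.
apply: (radius_near0 d0) => h hd.
case: z H {vp vxp vxx vxy vyp vyx vyy Uz Unear pnear fx fy} => x y H; case: h hd => p q hd.
set vx := partial_x v in H *; set vy := partial_y v in H *.
set N := complex.Re `|p +i* q| in hd *; rewrite /=.
have N0 : 0 <= N by apply: le_trans (normr_ge0 _) (abs_Re_le _).
set z0 := x +i* y in H *.
set vxx := partial_x vx z0 in H *; set vxy := partial_y vx z0 in H *.
set vyx := partial_x vy z0 in H *; set vyy := partial_y vy z0 in H *.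
clearbody vxx vxy vyx vyy.
have Bx : `|v ((x + p) +i* (y + q)) - v (x +i* (y + q)) -
    (vx z0 * p + vxx / 2 * p ^+ 2 + vxy * (p * q))| <= eps / 2 * N * `|p|.
  have := @mvt_bound_poly (fun t => v (t +i* (y + q)))
    ((vx z0 + vxy * q) *: 'X + (vxx / 2) *: (('X - x%:P) ^+ 2)) x (x + p) (eps / 2 * N).
  rewrite quadratic_horner_diff.
  have -> : (vx z0 + vxy * q) * p + vxx / 2 * p ^+ 2 = vx z0 * p + vxx / 2 * p ^+ 2 + vxy * (p * q).
    by rewrite mulrDl -[vxy * q * p]mulrA [q * p]mulrC addrAC.
  have -> : x + p - x = p by rewrite addrC addKr.
  apply => t tx.
  have := H ((t - x) +i* q); have -> : z0 + ((t - x) +i* q) = t +i* (y + q).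
    by apply/eqP; rewrite eq_complex /= addrC subrK !eqxx.
  have tN : complex.Re `|(t - x) +i* q| <= N by rewrite Re_norm_mono.
  case; first exact: le_lt_trans tN hd.
  move=> [tx' _] [tx'' _]; split; first exact: tx'.
  rewrite quadratic_deriv [2 * _]mulrC divfK ?pnatr_eq0 //.
  apply: (@le_trans _ _ (eps / 2 * complex.Re `|(t - x) +i* q|)); last first.
    by rewrite ler_wpM2l // ltW.
  apply: le_trans tx'' => /=.
  set D := derive1 _ _; have -> : vx (t +i* (y + q)) = D by [].
  have E3 (a b c d' : R) : a - (b + c + d') = a - b - (d' + c) by ring.
  by rewrite E3.
have By : `|v (x +i* (y + q)) - v z0 - (vy z0 * q + vyy / 2 * q ^+ 2)| <= eps / 2 * N * `|q|.
  have := @mvt_bound_poly (fun t => v (x +i* t))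
    (vy z0 *: 'X + (vyy / 2) *: (('X - y%:P) ^+ 2)) y (y + q) (eps / 2 * N).
  rewrite quadratic_horner_diff.
  have -> : y + q - y = q by rewrite addrC addKr.
  apply => t tx.
  have := H (0 +i* (t - y)); have -> : z0 + (0 +i* (t - y)) = x +i* t.
    by apply/eqP; rewrite eq_complex /= addr0 addrC subrK !eqxx.
  have tN : complex.Re `|0 +i* (t - y)| <= N by rewrite Re_norm_mono // normr0.
  case; first exact: le_lt_trans tN hd.
  move=> [_ tx'] [_ tx'']; split; first exact: tx'.
  rewrite quadratic_deriv [2 * _]mulrC divfK ?pnatr_eq0 //.
  apply: (@le_trans _ _ (eps / 2 * complex.Re `|0 +i* (t - y)|)); last first.
    by rewrite ler_wpM2l // ltW.
  apply: le_trans tx'' => /=.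
  set D := derive1 _ _; have -> : vy (x +i* t) = D by [].
  by rewrite mulr0 add0r opprD addrA.
have -> : z0 + (p +i* q) = (x + p) +i* (y + q) by [].
rewrite [X in `|X|](_ : _ = (v ((x + p) +i* (y + q)) - v (x +i* (y + q)) -
    (vx z0 * p + vxx / 2 * p ^+ 2 + vxy * (p * q))) +
   (v (x +i* (y + q)) - v z0 - (vy z0 * q + vyy / 2 * q ^+ 2))); last by ring.
apply: (le_trans (ler_normD _ _)); apply: (le_trans (lerD Bx By)).
have := abs_Re_le (p +i* q); have := abs_Im_le (p +i* q); rewrite -/N /= => hq hp.
have -> : eps * N ^+ 2 = eps / 2 * N * N + eps / 2 * N * N by field.
by rewrite lerD // ler_wpM2l // mulr_ge0 // ltW.
Unshelve. all: by end_near. Qed.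

End Taylor.

Section ComplexTopology.
Variable R : realType.
Local Notation C := R[i].

(** The coefficients of h^2 and of its conjugate stay existential: maxima and critical points depend
    only on the others. *)
Lemma jet_coef_eq (g : C -> C) (z c al be a b s c' al' be' s' : C) :
  jet g z c al be a b s -> c = c' -> al = al' -> be = be' -> s = s' ->
  exists a b, jet g z c' al' be' a b s'.
Proof. by move=> gj <- <- <- <-; exists a, b. Qed.

Lemma quarter_sum (a b : R) :
  ((a + b) / 4)%:C = (a / 2)%:C * 2^-1 + (b / 2)%:C * 2^-1.
Proof.
have -> : 2^-1 = (2^-1)%:C :> C by rewrite fmorphV rmorph_nat.
rewrite -[X in _ = X + _]rmorphM -[X in _ = _ + X]rmorphM -rmorphD.
by congr (_%:C); field.
Qed.

Lemma jet_class_C2 (U : set C) (v : C -> R) z : open U -> U z -> class_C 2 U v ->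
  exists a b, jet (fun x => (v x)%:C) z (v z)%:C
    ((partial_x v z)%:C / 2 - (partial_y v z)%:C * ('i / 2))
    ((partial_x v z)%:C / 2 + (partial_y v z)%:C * ('i / 2)) a b
    (laplacian v z / 4)%:C.
Proof.
move=> Uo Uz vC; have H := second_order Uo Uz vC.
have ReD (x y : C) : complex.Re (x + y) = complex.Re x + complex.Re y by case: x => ? ?; case: y.
have ImD (x y : C) : complex.Im (x + y) = complex.Im x + complex.Im y by case: x => ? ?; case: y.
have rcD (a b : R) : (a + b)%:C = a%:C + b%:C by rewrite rmorphD.
have rcM (a b : R) : (a * b)%:C = a%:C * b%:C by rewrite rmorphM.
(* The real coordinates of x - z, written through x and its conjugate so that the algebra of jets
   turns the real Taylor polynomial into one in h and conj h. *)
pose X x : C := 2^-1 * (x + x^*) + - (complex.Re z)%:C.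
pose Y x : C := 'i / 2 * (x^* + -1 * x) + - (complex.Im z)%:C.
have Xe h : X (z + h) = (complex.Re h)%:C.
  by rewrite /X addcJ mulrA mulVf ?pnatr_eq0 // mul1r ReD -rmorphB addrC addKr.
have Ye h : Y (z + h) = (complex.Im h)%:C.
  have iD (j a : C) : j / 2 * a = a / 2 * j by rewrite mulrC mulrA mulrAC.
  rewrite /Y mulN1r iD -ImJ_sub.
  by rewrite ImD -rmorphB addrC addKr.
have X0 : X z = 0 by have := Xe 0; rewrite addr0.
have Y0 : Y z = 0 by have := Ye 0; rewrite addr0.
have XJ := jetD (jetM (jet_cst z 2^-1) (jetD (jet_id z) (jet_conj (jet_id z))))
  (jet_cst z (- (complex.Re z)%:C)).
have {XJ} [a1 [b1 XJ]] : exists a b, jet X z 0 2^-1 2^-1 a b 0.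
  by apply: jet_coef_eq XJ _ _ _ _;
    [exact: X0|rewrite conjc0; ring|rewrite conjc1; ring|rewrite conjc0; ring].
have YJ := jetD (jetM (jet_cst z ('i / 2)) (jetD (jet_conj (jet_id z))
  (jetM (jet_cst z (-1)) (jet_id z)))) (jet_cst z (- (complex.Im z)%:C)).
have {YJ} [a2 [b2 YJ]] : exists a b, jet Y z 0 (- ('i / 2)) ('i / 2) a b 0.
  apply: jet_coef_eq YJ _ _ _ _; [exact: Y0| | |]; rewrite ?conjc0 ?conjc1;
    move: ('i / 2) => j; ring.
pose vx := (partial_x v z)%:C; pose vy := (partial_y v z)%:C.
pose vxx := (partial_x (partial_x v) z / 2)%:C; pose vxy := (partial_y (partial_x v) z)%:C.
pose vyy := (partial_y (partial_y v) z / 2)%:C.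
have J := jetD (jetD (jet_cst z (v z)%:C) (jetD (jetM (jet_cst z vx) XJ) (jetM (jet_cst z vy) YJ)))
   (jetD (jetD (jetM (jet_cst z vxx) (jetM XJ XJ)) (jetM (jet_cst z vxy) (jetM XJ YJ)))
     (jetM (jet_cst z vyy) (jetM YJ YJ))).
set T := (X in jet X) in J.
have vT : littleoh2 (fun h => (v (z + h))%:C - T (z + h)).
  move=> e e0.
  have er := RRe_real (gtr0_real e0).
  have re0 : 0 < complex.Re e by rewrite -ltcR er.
  have [d d0 Hd] := near0_radius (H _ re0).
  apply: (radius_near0 d0) => h /Hd {}Hd.
  have -> : T (z + h) = (v z + (partial_x v z * complex.Re h + partial_y v z * complex.Im h)
      + (partial_x (partial_x v) z / 2 * complex.Re h ^+ 2
         + partial_y (partial_x v) z * (complex.Re h * complex.Im h)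
         + partial_y (partial_y v) z / 2 * complex.Im h ^+ 2))%:C.
    by rewrite /T Xe Ye !expr2 !rcD; rewrite ![(_ * (_ * _))%:C]rcM ![(partial_x v z * _)%:C]rcM
      ![(partial_y v z * _)%:C]rcM ![(complex.Re h * _)%:C]rcM ![(complex.Im h * _)%:C]rcM.
  rewrite -rmorphB norm_ReE (norm_ReE h) -er -rmorphXn -rmorphM lecR.
  apply: le_trans Hd; rewrite normc_def /= expr0n addr0 sqrtr_sqr.
  by [].
have E := jet_perturb (f := fun x => (v x)%:C) J vT.
have lapE : (laplacian v z / 4)%:C = vxx * 2^-1 + vyy * 2^-1.
  exact: quarter_sum.
have ij : ('i / 2) * ('i / 2) = - (2^-1 * 2^-1) :> C.
  by rewrite mulrACA -expr2 sqr_i mulN1r.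
rewrite lapE -/vx -/vy.
apply: jet_coef_eq E _ _ _ _.
all: clear - ij; move: ('i / 2) ij => j ij.
all: clearbody vx vy vxx vxy vyy.
- ring.
- ring.
- ring.
have -> : vxx * 2^-1 + vyy * 2^-1 = vxx * (2^-1 * 2^-1 + 2^-1 * 2^-1) - 2 * vyy * (j * j).
  by rewrite ij; field.
by ring.
Qed.

End ComplexTopology.

(** * Continuity from expansions, compactness of the closed disk *)

Section Topology.
Variable R : realType.
Local Notation C := R[i].
Implicit Types z : C.

Lemma near0_continuous (g : C -> R) z :
  (forall e : R, 0 < e -> \forall h \near (0 : C), `|g (z + h) - g z| <= e) ->
  {for z, continuous g}.
Proof.
move=> H A /nbhs_normP [e /= e0 eA].
have e2 : 0 < e / 2 by rewrite divr_gt0.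
apply: (nbhs0P (fun x => A (g x)) z).2.
near=> h; apply: eA; rewrite /ball_ /= distrC (@le_lt_trans _ _ (e / 2)) //.
  by near: h; exact: H.
by rewrite ltr_pdivrMr // ltr_pMr // ltr1n.
Unshelve. all: by end_near. Qed.

Lemma ReB (x y : C) : complex.Re (x - y) = complex.Re x - complex.Re y.
Proof. by case: x => ? ?; case: y. Qed.

Lemma ReD (x y : C) : complex.Re (x + y) = complex.Re x + complex.Re y.
Proof. by case: x => ? ?; case: y. Qed.

Lemma lipschitz_continuous (g : C -> R) :
  (forall x y, `|g x - g y| <= complex.Re `|x - y|) -> continuous g.
Proof.
move=> gL x; apply: near0_continuous => e e0.
apply: (radius_near0 e0) => h hd.
by rewrite (le_trans (gL _ _)) // addrC addKr ltW.
Qed.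

Lemma continuous_norm_Re : continuous (fun x : C => complex.Re `|x|).
Proof.
apply: lipschitz_continuous => x y.
have H (a b : C) : complex.Re `|a| - complex.Re `|b| <= complex.Re `|a - b|.
  rewrite lerBlDr -lecR rmorphD -!norm_ReE.
  by have := ler_normD (a - b) b; rewrite subrK.
by rewrite ler_norml H lerNl opprB distrC H.
Qed.

Lemma jet_near0 (g : C -> C) z c al be a b s : jet g z c al be a b s ->
  forall e : C, 0 < e -> \forall h \near (0 : C), `|g (z + h) - g z| <= e.
Proof.
move=> gj e e0; have gz := jet_value gj; have [M M0 H] := jet_bigOh gj.
have M1 : 0 < M + 1 by rewrite ltr_wpDl.
near=> h; rewrite gz.
have h1 : `|g (z + h) - c| <= M * `|h| ^+ 1 by near: h; exact: H.
have h2 : `|h| < e / (M + 1) by near: h; apply: near0_norm_lt; rewrite divr_gt0.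
apply: (le_trans h1); rewrite expr1; apply: (@le_trans _ _ ((M + 1) * `|h|)).
  by rewrite ler_wpM2r // lerDl.
by rewrite -ler_pdivlMl // mulrC ltW.
Unshelve. all: by end_near. Qed.

Lemma jet_Re_continuous (g : C -> C) z c al be a b s : jet g z c al be a b s ->
  {for z, continuous (fun x => complex.Re (g x))}.
Proof.
move=> gj; apply: near0_continuous => e e0.
have e0' : 0 < e%:C by rewrite ltcR.
have [d d0 H] := near0_radius (jet_near0 gj e0').
apply: (radius_near0 d0) => h /H {}H.
by rewrite -ReB (le_trans (abs_Re_le _)) // -lecR -norm_ReE.
Qed.

Definition closed_disk : set C := [set z | complex.Re `|z| <= 1].

Lemma continuous_cplx : continuous (@cplx R).
Proof.
move=> [x y] A /nbhs_normP [e /= e0 eA].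
have er := RRe_real (gtr0_real e0).
have r2 : 0 < complex.Re e / 2 by rewrite divr_gt0 // -ltcR er.
exists (ball x (complex.Re e / 2), ball y (complex.Re e / 2)) => /=.
  by split; exact: nbhsx_ballx.
move=> [x' y'] [/= xx yy]; apply: eA; rewrite /ball_ /= /cplx /=.
have -> : (x +i* y) - (x' +i* y') = (x - x')%:C + 'i * (y - y')%:C.
  by apply/eqP; rewrite eq_complex /= !(mul0r, mul1r, mulr0, subr0, sub0r, addr0, add0r) !eqxx.
apply: (le_lt_trans (ler_normD _ _)).
have ni : `|'i : C| = 1 by rewrite normc_def /= expr0n expr1n add0r sqrtr1.
have nr (a : R) : `|a%:C| = `|a|%:C :> C.
  by rewrite normc_def /= expr0n addr0 sqrtr_sqr.
rewrite normrM ni mul1r !nr -rmorphD -er ltcR [ltRHS]splitr.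
exact: ltrD.
Qed.

Lemma closed_disk_compact : compact closed_disk.
Proof.
have cl : closed closed_disk.
  have := @closed_comp _ _ (fun x : C => complex.Re `|x|) [set x | x <= 1].
  apply; last exact: closed_le.
  by move=> x _; exact: continuous_norm_Re.
pose S : set (R * R) := `[(-1), 1]%classic `*` `[(-1), 1]%classic.
have cS : compact (@cplx R @` S).
  apply: continuous_compact; last by apply: compact_setX; exact: segment_compact.
  by apply: continuous_subspaceT => x; exact: continuous_cplx.
apply: subclosed_compact cl cS _ => z /= z1.
have := le_trans (abs_Re_le z) z1; have := le_trans (abs_Im_le z) z1.
rewrite !ler_norml => ? ?; exists (complex.Re z, complex.Im z); last by case: (z).
by split; rewrite /= in_itv.
Qed.

End Topology.

(** * Univalent polynomials on the disk *)

Section HarmonicExtension.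
Variable R : realType.
Local Notation C := R[i].
Local Notation conjp := (map_poly (@conjc R)).

Lemma conjcM (x y : C) : (x * y)^* = x^* * y^*.
Proof. exact: rmorphM. Qed.

Lemma conjcD (x y : C) : (x + y)^* = x^* + y^*.
Proof. exact: rmorphD. Qed.

Lemma conjc_half : (2^-1 : C)^* = 2^-1.
Proof. by rewrite conjc_inv conjc_nat. Qed.

(* Induction on [p = p1 X + c]: [|p|^2 = |c|^2 + |p1|^2 + 2 Re (conj c X p1)] on the
   circle. For [w = Re Q - |p|^2 / 2] the last two quantities are the radial derivative
   of [w], equal to minus the sum of the [|p_k|^2] over the successive quotients [p_k]
   of [p] by [X]. *)
Lemma harmonic_extension (p : {poly C}) : exists Q : {poly C},
  [/\ (size Q <= size p)%N,
      forall z, `|z| = 1 -> Q.[z] + (Q.[z])^* = p.[z] * (p.[z])^*,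
      forall z, `|z| = 1 -> z * ((deriv Q).[z] - (deriv p).[z] * (p.[z])^*) <= 0 &
      (1 < size p)%N -> forall z, `|z| = 1 ->
        z * ((deriv Q).[z] - (deriv p).[z] * (p.[z])^*) < 0].
Proof.
elim/poly_ind: p => [|p c [Q [sQ hQ rQ sr]]].
  exists 0; split; rewrite ?size_poly0 // => z _.
    by rewrite horner0 mul0r conjc0 addr0.
  by rewrite deriv0 horner0 mul0r subr0 mulr0.
have [p0|p0] := eqVneq p 0.
  exists (c * c^* / 2)%:P; rewrite p0 mul0r add0r; split.
  - by rewrite !size_polyC; have [->|_] := eqVneq c 0; [rewrite !mul0r eqxx|exact: leq_b1].
  - move=> z _; rewrite !hornerC !conjcM conjcK conjc_half.
    by rewrite [c^* * c]mulrC -splitr.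
  - by move=> z _; rewrite !derivC horner0 mul0r subr0 mulr0.
  - by rewrite size_polyC; case: (_ != _).
exists (Q + (c * c^* / 2)%:P + c^* *: (p * 'X)).
have key z : `|z| = 1 -> z * ((deriv (Q + (c * c^* / 2)%:P + c^* *: (p * 'X))).[z] -
    (deriv (p * 'X + c%:P)).[z] * ((p * 'X + c%:P).[z])^*) =
    z * ((deriv Q).[z] - (deriv p).[z] * (p.[z])^*) - p.[z] * (p.[z])^*.
  move=> z1; have zz : z * z^* = 1 by rewrite -sqr_normc z1 expr1n.
  have dp : (deriv (p * 'X + c%:P)).[z] = (deriv p).[z] * z + p.[z].
    by rewrite derivMXaddC hornerD hornerMX addrC.
  have dQ : (deriv (Q + (c * c^* / 2)%:P + c^* *: (p * 'X))).[z] =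
      (deriv Q).[z] + c^* * ((deriv p).[z] * z + p.[z]).
    by rewrite !derivD derivC addr0 derivZ hornerD hornerZ -dp derivD derivC addr0.
  rewrite dQ dp hornerMXaddC conjcD conjcM.
  move: ((deriv Q).[z]) ((deriv p).[z]) (p.[z]) => q' p' pz.
  have -> : z * (q' + c^* * (p' * z + pz) - (p' * z + pz) * (pz^* * z^* + c^*)) =
     z * q' - (z * z^*) * (z * p' * pz^* + pz * pz^*) by ring.
  by rewrite zz; ring.
split.
- rewrite size_MXaddC (negbTE p0) /=.
  rewrite (leq_trans (size_polyD _ _)) // geq_max (leq_trans (size_polyD _ _)) ?geq_max.
    by rewrite (leq_trans (size_scale_leq _ _)) // size_mulX.
  by rewrite (leq_trans sQ) // (leq_trans (size_polyC_leq1 _)).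
- move=> z z1; have zz : z * z^* = 1 by rewrite -sqr_normc z1 expr1n.
  have Qv : (Q + (c * c^* / 2)%:P + c^* *: (p * 'X)).[z] = Q.[z] + c * c^* / 2 + c^* * (p.[z] * z).
    by rewrite !hornerD hornerC hornerZ hornerMX.
  rewrite Qv hornerMXaddC !conjcD !conjcM conjcK conjc_half.
  have -> : Q.[z] + c * c^* / 2 + c^* * (p.[z] * z) +
     ((Q.[z])^* + c^* * c / 2 + c * ((p.[z])^* * z^*)) =
     (Q.[z] + (Q.[z])^*) + c * c^* + c^* * (p.[z] * z) + c * ((p.[z])^* * z^*) by field.
  rewrite hQ //.
  have -> : p.[z] * (p.[z])^* = (z * z^*) * (p.[z] * (p.[z])^*) by rewrite zz mul1r.
  ring.
- move=> z z1; rewrite key // subr_le0 (le_trans (rQ _ z1)) //.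
  exact: mulcJ_ge0.
- move=> _ z z1; rewrite key // subr_lt0.
  (* Strictness comes from the last nonzero quotient: either the induction hypothesis has it
     already, or [p] is a nonzero constant and -|p|^2 < 0. *)
  have [sp|sp] := leqP (size p) 1; last by rewrite (lt_le_trans (sr sp _ z1)) // mulcJ_ge0.
  rewrite (le_lt_trans (rQ _ z1)) // lt_def mulcJ_ge0 andbT.
  have /size_poly1P [d d0 ->] : size p == 1%N by rewrite eqn_leq sp size_poly_gt0.
  by rewrite hornerC mulf_neq0 // conjc_eq0.
Qed.

End HarmonicExtension.

(** * Consequences of injectivity in the disk and on the circle *)

Section Univalent.
Variable R : realType.
Local Notation C := R[i].
Variables (p : {poly C}) (n : nat).
Hypothesis sp : size p = n.+1.
Hypothesis inj_p : forall x y : C, `|x| < 1 -> `|y| < 1 -> p.[x] = p.[y] -> x = y.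

Lemma univalent_degree_gt0 : (0 < n)%N.
Proof.
rewrite lt0n; apply/negP => /eqP n0.
have [c _ pE] : exists2 c, c != 0 & p = c%:P by apply/size_poly1P; rewrite sp n0.
have := @inj_p 0 (2^-1); rewrite pE !hornerC normr0 ltr01 => /(_ erefl).
rewrite ger0_norm ?invr_ge0 ?ler0n // invf_lt1 ?ltr0n // ltr1n => /(_ erefl erefl)/eqP.
by rewrite eq_sym invr_eq0 pnatr_eq0.
Qed.

(* By injectivity the roots of the quotient [q] lie outside the disk. *)
Lemma univalent_lower_bound (r a : C) : `|r| < 1 -> `|a| < 1 -> (deriv p).[r] != 0 ->
  exists q : {poly C}, [/\ p - p.[r]%:P = q * ('X - r%:P), q.[r] = (deriv p).[r] &
    `|lead_coef p| * (1 - `|a|) ^+ n.-1 <= `|q.[a]|].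
Proof.
move=> r1 a1 pr0.
have /factor_theorem [q qE] : root (p - p.[r]%:P) r by rewrite /root hornerD hornerN hornerC subrr.
have pE : p = q * ('X - r%:P) + p.[r]%:P by rewrite -qE subrK.
have qr : q.[r] = (deriv p).[r].
  rewrite [in RHS]pE derivD derivC addr0 derivM derivXsubC mulr1 hornerD hornerM hornerXsubC.
  by rewrite subrr mulr0 add0r.
exists q; split => //.
have n0 := univalent_degree_gt0.
have sq : size q = n.
  have : size (p - p.[r]%:P) = n.+1.
    by rewrite size_polyDl ?sp // size_polyN (leq_ltn_trans (size_polyC_leq1 _)).
  have q0 : q != 0 by apply: contraNneq pr0 => q0; rewrite -qr q0 horner0.
  by rewrite qE size_Mmonic ?monicXsubC // size_XsubC addn2 => -[].
have lq : lead_coef q = lead_coef p.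
  rewrite pE lead_coefDl ?lead_coef_Mmonic ?monicXsubC //.
  by rewrite -qE size_polyDl ?sp ?size_polyN (leq_ltn_trans (size_polyC_leq1 _)) // sp.
have [rs qrs] := closed_field_poly_normal q.
have q0 : q != 0 by rewrite -size_poly_gt0 sq.
have srs : size rs = n.-1.
  have : size q = (size rs).+1 by rewrite {1}qrs size_scale ?lead_coef_eq0 // size_prod_XsubC.
  by rewrite sq => ->.
rewrite qrs hornerZ normrM lq ler_wpM2l // -srs horner_prod.
have : all (fun s => 1 <= `|s|) rs.
  apply/allP => s srs'; rewrite real_leNgt ?real1 ?normr_real //; apply/negP => s1.
  have qs : q.[s] = 0.
    by apply/rootP; rewrite qrs rootZ ?lead_coef_eq0 // root_prod_XsubC.
  have : s = r.
    apply: inj_p => //.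
    by rewrite pE !hornerD !hornerM qs !hornerC !hornerXsubC subrr mul0r mulr0.
  by move=> sr; move: pr0; rewrite -qr -sr qs eqxx.
elim: rs {qrs srs} => [|s rs IH] /=; first by rewrite big_nil normr1.
move=> /andP[s1 rs1]; rewrite big_cons normrM exprS.
have ra : 0 <= 1 - `|a| by rewrite subr_ge0 ltW.
apply: ler_pM; rewrite ?exprn_ge0 //; last exact: IH.
rewrite hornerXsubC; apply: (@le_trans _ _ (`|s| - `|a|)); first by rewrite lerD2r.
by rewrite distrC lerB_dist.
Qed.

(* The lower bound on [|p'|] holds wherever [p'] does not vanish, hence everywhere by
   continuity. *)
Lemma univalent_deriv_neq0 (r : C) : `|r| < 1 -> (deriv p).[r] != 0.
Proof.
move=> r1; apply/negP => /eqP pr0.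
have n0 := univalent_degree_gt0.
have p0 : p != 0 by rewrite -size_poly_gt0 sp.
have dp0 : deriv p != 0.
  apply/negP => /eqP dp; have := coef_deriv p n.-1; rewrite dp coef0 prednK //.
  have -> : p`_n = lead_coef p by rewrite lead_coefE sp.
  by move=> /esym/eqP; rewrite mulrn_eq0 lead_coef_eq0 (negbTE p0) orbF eqn0Ngt n0.
(* Factoring out the zero at [r] shows that [p'] has no other zero nearby. Both points of the lower
   bound are then taken at [r + h], where the quotient takes the value p'(r + h). *)
have [m [q qr0 pE]] := multiplicity_XsubC (deriv p) r.
rewrite dp0 /= in qr0.
have m0 : (0 < m)%N.
  case: m pE => // pE; move: pr0; rewrite pE expr0 mulr1 => /rootP; by rewrite (negbTE qr0).
have [a qj] := jet_poly q r.
have qr0' : q.[r] != 0 by move: qr0; rewrite /root.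
have away := jet_away0 qr0' qj.
have [a' pj] := jet_poly (deriv p) r.
have rr : 0 < 1 - `|r| by rewrite subr_gt0.
have K0 : 0 < `|lead_coef p| * ((1 - `|r|) / 2) ^+ n.-1.
  by rewrite mulr_gt0 ?exprn_gt0 ?divr_gt0 // normr_gt0 lead_coef_eq0.
have K2 : 0 < `|lead_coef p| * ((1 - `|r|) / 2) ^+ n.-1 / 2 by rewrite divr_gt0.
have small := jet_near0 pj K2.
have rr2 : 0 < (1 - `|r|) / 2 by rewrite divr_gt0.
have [d d0 H] := near0_radius (filterI away (filterI small (near0_norm_lt rr2))).
pose h : C := (d / 2)%:C.
have hn : `|h| = (d / 2)%:C by rewrite normc_def /= expr0n addr0 sqrtr_sqr gtr0_norm // divr_gt0.
have hd : complex.Re `|h| < d by rewrite hn /= ltr_pdivrMr // ltr_pMr // ltr1n.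
have [/= h1 [h2 h3]] := H h hd.
have h0 : h != 0 by rewrite -normr_gt0 hn ltcR divr_gt0.
have ph0 : (deriv p).[r + h] != 0.
  have rh : r + h - r = h by rewrite addrC addKr.
  rewrite pE hornerM horner_exp hornerXsubC rh mulf_neq0 ?expf_neq0 //.
  by rewrite -normr_gt0 (lt_le_trans _ h1) // divr_gt0 // normr_gt0.
have rh1 : `|r + h| < 1.
  apply: (le_lt_trans (ler_normD _ _)); rewrite -ltrBrDl (lt_trans h3) //.
  by rewrite ltr_pdivrMr // ltr_pMr // ltr1n.
have [q' [_ q'E q'b]] := univalent_lower_bound rh1 rh1 ph0.
rewrite q'E in q'b; rewrite pr0 subr0 in h2.
suff lt : `|lead_coef p| * ((1 - `|r|) / 2) ^+ n.-1 / 2 < `|lead_coef p| * (1 - `|r + h|) ^+ n.-1.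
  by have := le_lt_trans (le_trans q'b h2) lt; rewrite ltxx.
apply: (@lt_le_trans _ _ (`|lead_coef p| * ((1 - `|r|) / 2) ^+ n.-1)).
  by rewrite ltr_pdivrMr // ltr_pMr // ltr1n.
apply: ler_wpM2l => //; apply: lerXn2r; rewrite ?nnegrE ?(ltW rr2) //.
  by rewrite subr_ge0 ltW.
rewrite lerBrDr; apply: (@le_trans _ _ ((1 - `|r|) / 2 + (`|r| + (1 - `|r|) / 2))).
  by rewrite lerD2l (le_trans (ler_normD r h)) // lerD2l ltW.
by rewrite addrCA -splitr addrC subrK.
Qed.

(** For r = (1 - t) b, the lower bound on the quotient keeps p(a) - p(r) away from 0 uniformly in
    small t, while p(r) tends to p(b). *)
Lemma univalent_boundary (a b : C) : `|a| < 1 -> `|b| = 1 -> p.[a] != p.[b].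
Proof.
move=> a1 b1; apply/negP => /eqP pab.
have n0 := univalent_degree_gt0.
have p0 : p != 0 by rewrite -size_poly_gt0 sp.
have ra : 0 < 1 - `|a| by rewrite subr_gt0.
have ra2 : 0 < (1 - `|a|) / 2 by rewrite divr_gt0.
have K0 : 0 < `|lead_coef p| * (1 - `|a|) ^+ n.-1.
  by rewrite mulr_gt0 ?exprn_gt0 // normr_gt0 lead_coef_eq0.
have e0 : 0 < `|lead_coef p| * (1 - `|a|) ^+ n.-1 * ((1 - `|a|) / 2) / 2 by rewrite divr_gt0 // mulr_gt0.
have [a' pj] := jet_poly p b.
have [d d0 H] := near0_radius (filterI (jet_near0 pj e0) (near0_norm_lt ra2)).
pose t := Num.min (d / 2) (1 / 2).
have t0 : 0 < t by rewrite lt_min !divr_gt0.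
have t1 : t < 1 by rewrite gt_min orbC ltr_pdivrMr // mul1r ltr1n.
have td : t < d by rewrite gt_min ltr_pdivrMr // ltr_pMr // ltr1n.
pose h : C := - (t%:C * b).
have hn : `|h| = t%:C.
  by rewrite normrN normrM b1 mulr1 normc_def /= expr0n addr0 sqrtr_sqr gtr0_norm.
have hd : complex.Re `|h| < d by rewrite hn.
have [/= h1 h2] := H h hd.
have bh : `|b + h| = (1 - t)%:C.
  have -> : b + h = (1 - t)%:C * b by rewrite rmorphB rmorph1 mulrBl mul1r.
  by rewrite normrM b1 mulr1 normc_def /= expr0n addr0 sqrtr_sqr gtr0_norm // subr_gt0.
have bh1 : `|b + h| < 1 by rewrite bh -[ltRHS]/((1 : R)%:C) ltcR ltrBlDr ltrDl.
have [q [qE _ qb]] := univalent_lower_bound bh1 a1 (univalent_deriv_neq0 bh1).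
have := congr1 (fun u : {poly C} => `|u.[a]|) qE.
rewrite hornerM hornerD hornerN hornerC hornerXsubC normrM pab distrC => E.
rewrite E in h1.
suff lt : `|lead_coef p| * (1 - `|a|) ^+ n.-1 * ((1 - `|a|) / 2) / 2 < `|q.[a]| * `|a - (b + h)|.
  by have := le_lt_trans h1 lt; rewrite ltxx.
apply: (@lt_le_trans _ _ (`|lead_coef p| * (1 - `|a|) ^+ n.-1 * ((1 - `|a|) / 2))).
  by rewrite ltr_pdivrMr // ltr_pMr ?ltr1n // mulr_gt0.
apply: ler_pM; rewrite ?(ltW K0) ?(ltW ra2) //.
rewrite distrC; apply: le_trans (lerB_dist _ _).
have -> : `|b + h| = 1 - `|h| by rewrite bh hn rmorphB.
rewrite lerBrDr lerBrDr.
apply: (@le_trans _ _ ((1 - `|a|) / 2 + `|a| + (1 - `|a|) / 2)); first by rewrite lerD2l ltW.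
by rewrite addrAC -splitr subrK.
Qed.

End Univalent.

(** * Zeros of real polynomials in [x] and [x^*] *)

Section RealPoints.
Variable R : realType.
Local Notation C := R[i].
Local Notation conjp := (map_poly (@conjc R)).
Implicit Types (c f : {poly {poly C}}) (p Q : {poly C}) (z : C).

(* The real points are the points [y = x^*]. *)
Definition real_eval c z : C := c.[(z^*)%:P].[z].

Lemma jet_real_eval c z : exists al be a b s, jet (real_eval c) z (real_eval c z) al be a b s.
Proof.
suff [x [al [be [a [b [s J]]]]]] : exists x al be a b s, jet (real_eval c) z x al be a b s.
  by exists al, be, a, b, s; rewrite (jet_value J).
elim/poly_ind: c => [|c d [x [al [be [a [b [s J]]]]]]].
  exists 0, 0, 0, 0, 0, 0; have -> : real_eval 0 = fun=> 0; last exact: jet_cst.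
  by apply/funext => w; rewrite /real_eval !horner0.
have [a' Jd] := jet_poly d z.
have J' := jetD (jetM J (jet_conj (jet_id z))) Jd.
do 6 eexists.
have -> : real_eval (c * 'X + d%:P) = fun w => real_eval c w * w^* + d.[w]; last exact: J'.
by apply/funext => w; rewrite /real_eval hornerMXaddC hornerD hornerM hornerC.
Qed.

Lemma jet_unique (g : C -> C) z (x al be a b s x' al' be' a' b' s' : C) :
  jet g z x al be a b s -> jet g z x' al' be' a' b' s' -> al = al' /\ be = be'.
Proof.
move=> J J'.
have key (c1 al1 be1 a1 b1 s1 c2 al2 be2 a2 b2 s2 : C) (g1 : C -> C) :
    jet g1 z c1 al1 be1 a1 b1 s1 -> jet g1 z c2 al2 be2 a2 b2 s2 -> al1 = al2.
  move=> J1 J2.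
  have := jetD J1 (jetM (jet_cst z (-1)) J2).
  rewrite -(jet_value J1) -(jet_value J2) !mul0r !addr0 !mulN1r subrr.
  have -> : (fun y => g1 y + -1 * g1 y) = fun=> 0 by apply/funext => y; rewrite mulN1r subrr.
  by move=> /jet0_linear /eqP; rewrite subr_eq0 => /eqP.
split; first exact: key J J'.
by apply: (can_inj (@conjcK R)); exact: key (jet_conj J) (jet_conj J').
Qed.

(* If [g >= 0] near [z], then [g ^ 2 - N g] has a local maximum at [z] for every
   [N > 0], although its mixed derivative is [2 |be| ^ 2 - N s]. *)
Lemma real_jet_negative (g : C -> C) z al be a b s : (forall x, (g x)^* = g x) ->
  jet g z 0 al be a b s -> be != 0 ->
  forall d : R, 0 < d -> exists2 h, complex.Re `|h| < d & complex.Re (g (z + h)) < 0.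
Proof.
move=> gr J be0 d d0; apply: contrapT => H.
have {}H h : complex.Re `|h| < d -> 0 <= complex.Re (g (z + h)).
  by move=> hd; rewrite leNgt; apply/negP => gneg; apply: H; exists h.
have alE : al = be^*.
  have := jet_conj J; have -> : (fun x => (g x)^*) = g by apply/funext.
  by move=> /(jet_unique J) [].
have bb : 0 < complex.Re (al * be).
  rewrite alE mulrC; have : 0 < be * be^* by rewrite lt_def mulcJ_ge0 mulf_neq0 // conjc_eq0.
  by rewrite ltcE /= => /andP[].
(* Small enough that N Re s <= |be|^2, whence 2 |be|^2 - N Re s > 0. Near [z], 0 <= g <= N makes g^2
   - N g nonpositive. *)
pose N := complex.Re (al * be) / (`|complex.Re s| + 1).
have S1 : 0 < `|complex.Re s| + 1 by rewrite ltr_wpDl.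
have N0 : 0 < N by rewrite divr_gt0.
have J2 := jetD (jetM J J) (jetM (jet_cst z (- N%:C)) J).
have gR x : g x = (complex.Re (g x))%:C.
  by rewrite ReJ_add gr mulrDl -splitr.
have g0 := jet_value J.
have N0' : 0 < N%:C by rewrite ltcR.
have [e e0 Hs] := near0_radius (jet_near0 J N0').
have : complex.Re (0 * s + s * 0 + (al * be + be * al) + (- N%:C * s + 0 * 0 + (0 * be + 0 * al))) <= 0.
  apply: local_max_jet J2 _.
  have m0 : 0 < Num.min d e by rewrite lt_min d0.
  apply: (radius_near0 m0) => h; rewrite lt_min => /andP[/H Hd /Hs].
  rewrite g0 subr0 norm_ReE lecR => gN.
  rewrite gR -rmorphN -!rmorphM -rmorphD /= mul0r mulr0 addr0.
  have := le_trans (ler_norm _) (le_trans (abs_Re_le _) gN) => gN'.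
  rewrite mulNr -mulrBl mulr_le0_ge0 // subr_le0 //.
rewrite !mul0r !mulr0 !add0r !addr0 [be * al]mulrC !ReD.
have -> : complex.Re (- N%:C * s) = - (N * complex.Re s) by case: (s) => s1 s2 /=; ring.
have : N * complex.Re s <= complex.Re (al * be).
  rewrite /N mulrAC ler_pdivrMr // ler_pM2l // (le_trans (ler_norm _)) // lerDl //.
by move: bb; lra.
Qed.

(** Every point of the circle is joined to 1 by an arc of the upper or lower semicircle, a graph
    over the real part, on which the intermediate value theorem applies; [e] selects the
    semicircle. *)
Lemma circle_sign (g : C -> R) : continuous g -> (forall z, `|z| = 1 -> g z != 0) ->
  (forall z, `|z| = 1 -> 0 < g z) \/ (forall z, `|z| = 1 -> g z < 0).
Proof.
move=> gc gn.
have key z : `|z| = 1 -> 0 < g z * g 1.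
  move=> z1; rewrite ltNge; apply/negP => gz.
  case: z z1 gz => x y z1 gz.
  have xy : x ^+ 2 + y ^+ 2 = 1.
    by apply: complexI; rewrite (add_Re2_Im2 (x +i* y)) z1 expr1n.
  have x1 : x ^+ 2 <= 1 by rewrite -xy lerDl sqr_ge0.
  have /andP[xm xM] : -1 <= x <= 1 by rewrite -ler_norml -(@expr_le1 _ 2) // real_normK ?num_real.
  pose e : R := if 0 <= y then 1 else -1.
  pose G t := g (t +i* (e * Num.sqrt (1 - t ^+ 2))).
  have Gc : continuous G.
    pose k t := cplx (t, e * Num.sqrt (1 - t ^+ 2)).
    have kc : continuous k.
      move=> t; apply: (@continuous_comp _ _ _ (fun t : R => (t, e * Num.sqrt (1 - t ^+ 2))) (@cplx R)).
        have cs : {for t, continuous (fun t : R => e * Num.sqrt (1 - t ^+ 2))}.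
          apply: cvgM; first exact: cvg_cst.
          apply: (@continuous_comp _ _ _ (fun t : R => 1 - t ^+ 2) (@Num.sqrt R));
            last exact: sqrt_continuous.
          by apply: cvgB; [exact: cvg_cst|exact: exprn_continuous].
        have ci : {for t, continuous (fun t : R => t)} by exact: cvg_id.
        exact: (cvg_pair ci cs).
      exact: continuous_cplx.
    by move=> t; apply: (@continuous_comp _ _ _ k g); [exact: kc|exact: gc].
  have G1 : G 1 = g 1 by rewrite /G expr1n subrr sqrtr0 mulr0.
  have Gx : G x = g (x +i* y).
    rewrite /G -xy addrC addKr sqrtr_sqr /e.
    by case: (leP 0 y) => y0; [rewrite mul1r ger0_norm|rewrite ltr0_norm // mulrNN mul1r].
  have : exists2 t, t \in `[x, 1]%R & G t = 0.
    apply: IVT => //; first exact: continuous_subspaceT.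
    rewrite G1 Gx ge_min le_max; apply/andP; split; apply: contraTT gz.
      by rewrite negb_or -!ltNge => /andP[? ?]; rewrite mulr_gt0.
    by rewrite negb_or -!ltNge => /andP[gx ?]; rewrite nmulr_lgt0.
  move=> [t]; rewrite in_itv /= => /andP[xt t1] /eqP; apply/negP/gn.
  have tt : t ^+ 2 <= 1.
    rewrite -(real_normK (num_real t)) -[leRHS](expr1n _ 2) lerXn2r ?nnegrE //.
    by rewrite ler_norml t1 (le_trans xm).
  rewrite normc_def /= exprMn sqr_sqrtr ?subr_ge0 //.
  have -> : e ^+ 2 = 1 by rewrite /e; case: ifP; rewrite ?sqrrN expr1n.
  by rewrite mul1r addrC subrK sqrtr1.
have [g1|g1] := ltrP 0 (g 1).
  by left => z /key; rewrite pmulr_lgt0.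
right => z z1; have g1' : g 1 < 0 by rewrite lt_neqAle g1 gn // normr1.
by have := key _ z1; rewrite nmulr_lgt0.
Qed.

End RealPoints.

(** * The common factor has no zero in the disk *)

Section NoRealZero.
Variable R : realType.
Local Notation C := R[i].

Definition has_jets (g : C -> C) := forall z, exists al be a b s, jet g z (g z) al be a b s.

Lemma has_jetsN (g : C -> C) : has_jets g -> has_jets (fun x => - g x).
Proof.
move=> gj z; have [al [be [a [b [s J]]]]] := gj z.
have := jetM (jet_cst z (-1)) J; rewrite mulN1r.
have -> : (fun x => -1 * g x) = (fun x => - g x) by apply/funext => x; rewrite mulN1r.
by move=> J'; do 5 eexists; exact: J'.
Qed.

Lemma has_jets_Re_continuous (g : C -> C) : has_jets g -> continuous (fun x => complex.Re (g x)).
Proof. by move=> gj z; have [al [be [a [b [s J]]]]] := gj z; exact: jet_Re_continuous J. Qed.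

Lemma Re_mulcJ_ge0 (x : C) : 0 <= complex.Re (x * x^*).
Proof. by have := mulcJ_ge0 x; rewrite lecE => /andP[]. Qed.

Lemma Re_mulcJ_gt0 (x : C) : x != 0 -> 0 < complex.Re (x * x^*).
Proof.
move=> x0; have : 0 < x * x^* by rewrite lt_def mulcJ_ge0 mulf_neq0 // conjc_eq0.
by rewrite ltcE => /andP[].
Qed.

(* On [{g < 0}], which would be compactly contained in the disk, the harmonic
   function [q/p' - conj p] has modulus vanishing on the boundary, whereas the
   square of its modulus is strictly subharmonic. *)
Lemma no_real_zero_pos (p q : {poly C}) (g k : C -> C) :
  (forall z, `|z| < 1 -> (deriv p).[z] != 0) ->
  has_jets g -> has_jets k -> (forall z, (g z)^* = g z) ->
  (forall z, g z * k z = q.[z] - (deriv p).[z] * (p.[z])^*) ->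
  (forall z, `|z| = 1 -> 0 < complex.Re (g z)) ->
  forall z, `|z| < 1 -> g z != 0.
Proof.
move=> p'0 gj kj gr gk gpos z0 z01; apply/negP => /eqP gz0.
have gR x : g x = (complex.Re (g x))%:C.
  by rewrite ReJ_add gr mulrDl -splitr.
have gc := has_jets_Re_continuous gj.
have [al [be [a [b [s J]]]]] := gj z0; rewrite gz0 in J.
(* At a zero of [g], comparing the coefficients of conj h in g k = q - p' conj(p) gives be k(z0) =
   -|p'(z0)|^2, which is nonzero. By [real_jet_negative], [g] is then negative somewhere near
   [z0]. *)
have be0 : be != 0.
  have [al' [be' [a' [b' [s' J']]]]] := kj z0.
  have JM := jetM J J'.
  have [aq Jq] := jet_poly q z0; have [ap Jp] := jet_poly p z0.
  have [ap' Jp'] := jet_poly (deriv p) z0.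
  have := jetD Jq (jetM (jet_cst z0 (-1)) (jetM Jp' (jet_conj Jp))).
  have -> : (fun x => q.[x] + -1 * ((deriv p).[x] * (p.[x])^*)) = (fun x => g x * k x).
    by apply/funext => x; rewrite gk mulN1r.
  move=> /(jet_unique JM) [_]; rewrite !mul0r !add0r mulN1r !addr0 => beE.
  apply: contraNneq (p'0 _ z01) => b0; rewrite b0 mul0r in beE.
  by move/esym/eqP: beE; rewrite oppr_eq0 mulf_eq0 conjc_eq0 orbb.
pose V := @closed_disk R `&` [set x | complex.Re (g x) <= 0].
have Vin x : V x -> `|x| < 1.
  move=> [/=]; rewrite /closed_disk /= => x1 gx; rewrite lt_neqAle; apply/andP; split.
    by apply/eqP => x1'; have := gpos _ x1'; rewrite ltNge gx.
  by rewrite norm_ReE -[leRHS]/((1 : R)%:C) lecR.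
have inV x : `|x| < 1 -> complex.Re (g x) < 0 -> V x.
  move=> x1 gx; split => /=; last exact: ltW.
  by rewrite /closed_disk /= -lecR -norm_ReE ltW.
have cV : compact V.
  apply: compact_closedI; first exact: closed_disk_compact.
  have := @closed_comp _ _ (fun x : C => complex.Re (g x)) [set x | x <= 0].
  by apply; [move=> x _; exact: gc|exact: closed_le].
have d0 : 0 < complex.Re (1 - `|z0|).
  by rewrite ReB subr_gt0 -ltcR -norm_ReE.
have [h hd gneg] := real_jet_negative gr J be0 d0.
have u1 : `|z0 + h| < 1.
  apply: (le_lt_trans (ler_normD _ _)); rewrite -ltrBrDl norm_ReE.
  have rz : 1 - `|z0| \is Num.real by rewrite realB ?real1 ?normr_real.
  by rewrite -[ltRHS](RRe_real rz) ltcR.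
pose F x := q.[x] / (deriv p).[x] - (p.[x])^*.
have F0 x : `|x| < 1 -> g x = 0 -> F x = 0.
  move=> x1 gx; have := gk x; rewrite gx mul0r => /esym/eqP; rewrite subr_eq0 => /eqP qE.
  by rewrite /F qE mulrC mulKf ?subrr // p'0.
(* [F] is a holomorphic plus an antiholomorphic function, so the mixed coefficient of |F|^2 is the
   sum of the squared moduli of its two first-order coefficients, the second being |p'|^2 > 0. *)
have FJ x : `|x| < 1 -> exists al be a b s,
    [/\ jet (fun x => F x * (F x)^*) x (F x * (F x)^*) al be a b s & 0 < complex.Re s].
  move=> x1; have px0 := p'0 x x1.
  have [aq Jq] := jet_poly q x; have [ap Jp] := jet_poly p x.
  have [ap' Jp'] := jet_poly (deriv p) x.
  have JF := jetD (jetM Jq (jetV px0 Jp')) (jetM (jet_cst x (-1)) (jet_conj Jp)).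
  have FE : (fun y => q.[y] * ((deriv p).[y])^-1 + -1 * (p.[y])^*) = F.
    by apply/funext => y; rewrite mulN1r.
  rewrite FE in JF.
  have vF := jet_value JF; rewrite -vF !conjc0 !(mulr0, mul0r, addr0, add0r, oppr0) !mulN1r in JF.
  have JM := jetM JF (jet_conj JF); rewrite !conjc0 !(mulr0, mul0r, addr0, add0r) in JM.
  do 5 eexists; split; first exact: JM.
  by rewrite ReD ltr_wpDl ?Re_mulcJ_ge0 // Re_mulcJ_gt0 // oppr_eq0 conjc_eq0.
pose M x := complex.Re (F x * (F x)^*).
have M0 x : 0 <= M x by exact: Re_mulcJ_ge0.
have Mc : {within V, continuous M}.
  apply: continuous_in_subspaceT => x /set_mem /Vin /FJ [? [? [? [? [? [JM _]]]]]].
  exact: jet_Re_continuous JM.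
have Vu : V (z0 + h) by exact: inV.
have [m /set_mem Vm Mm] := compact_EVT_max (ex_intro _ _ Vu) cV Mc.
(* A local maximum needs a point interior to [V]. If the maximum sits where g = 0, then |F|^2
   vanishes on all of [V] and [z0 + h], where g < 0, is a maximum as well. *)
have {m Vm Mm} [m [m1 gm Mm]] : exists m,
    [/\ `|m| < 1, complex.Re (g m) < 0 & forall t, V t -> M t <= M m].
  have [gm|gm] := ltP (complex.Re (g m)) 0.
    by exists m; split => //; [exact: Vin|move=> t Vt; apply: Mm; exact/mem_set].
  have gm0 : g m = 0.
    rewrite gR; suff -> : complex.Re (g m) = 0 by [].
    by apply: le_anti; rewrite gm andbT; case: Vm.
  exists (z0 + h); split => // t Vt; apply: le_trans (M0 _).
  have := Mm t (mem_set Vt); rewrite {2}/M F0 ?mul0r //; exact: Vin.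
have [? [? [? [? [s' [JM]]]]]] := FJ m m1; apply/negP; rewrite -leNgt.
apply: local_max_jet JM _.
have cg : \forall h \near (0 : C), complex.Re (g (m + h)) < 0.
  have r0 : 0 < - complex.Re (g m) / 2 by rewrite divr_gt0 // oppr_gt0.
  have [d dp Hd] := near0_radius (continuous_near0 (gc m) r0).
  apply: (radius_near0 dp) => h' /Hd.
  by rewrite ler_norml => /andP[_]; lra.
have cm : \forall h \near (0 : C), `|h| < 1 - `|m| by apply: near0_norm_lt; rewrite subr_gt0.
near=> h'; apply: Mm; apply: inV; last by near: h'.
have h'1 : `|h'| < 1 - `|m| by near: h'.
by apply: (le_lt_trans (ler_normD _ _)); rewrite -ltrBrDl.
Unshelve. all: by end_near. Qed.

(** On the circle [g] is real and divides a nonvanishing function, so its sign is constant;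
    replacing [g] and [k] by their opposites reduces to the positive case. *)
Lemma no_real_zero (p q : {poly C}) (g k : C -> C) :
  (forall z, `|z| < 1 -> (deriv p).[z] != 0) ->
  (forall z, `|z| = 1 -> q.[z] - (deriv p).[z] * (p.[z])^* != 0) ->
  has_jets g -> has_jets k -> (forall z, (g z)^* = g z) ->
  (forall z, g z * k z = q.[z] - (deriv p).[z] * (p.[z])^*) ->
  forall z, `|z| < 1 -> g z != 0.
Proof.
move=> p'0 f0 gj kj gr gk z z1.
have [||pos|neg] := @circle_sign R (fun x => complex.Re (g x)).
- exact: has_jets_Re_continuous.
- move=> x x1; apply: contraNneq (f0 x x1) => gx.
  by rewrite -gk (_ : g x = 0) ?mul0r // -[g x]RRe_real ?gx // CrealE; exact/eqP/gr.
- exact: no_real_zero_pos gk pos z z1.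
rewrite -oppr_eq0; apply: (@no_real_zero_pos p q (fun x => - g x) (fun x => - k x)) => //.
- exact: has_jetsN.
- exact: has_jetsN.
- by move=> x; rewrite -[in RHS]gr rmorphN.
- by move=> x; rewrite mulrNN.
- by move=> x x1; have := neg x x1; case: (g x) => u v /=; rewrite oppr_gt0.
Qed.

End NoRealZero.

(** * The landscape function *)

Section Landscape.
Variable R : realType.
Local Notation C := R[i].
Local Notation conjp := (map_poly (@conjc R)).

(** Adding e (|x|^2 - 1) makes the mixed coefficient strictly positive and changes nothing on the
    circle; with e half the supposed positive value at [z], the sum is still positive there, so its
    maximum is interior. *)
Lemma disk_max_principle (u : C -> C) :
  {within @closed_disk R, continuous (fun x => complex.Re (u x))} ->
  (forall z, `|z| = 1 -> complex.Re (u z) <= 0) ->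
  (forall z, `|z| < 1 -> exists al be a b s, jet u z (u z) al be a b s /\ 0 <= complex.Re s) ->
  forall z, `|z| < 1 -> complex.Re (u z) <= 0.
Proof.
move=> uc ub uj z z1; rewrite leNgt; apply/negP => uz.
pose e := complex.Re (u z) / 2.
have e0 : 0 < e by rewrite divr_gt0.
pose U (x : C) := u x + e%:C * (x * x^* - 1).
have xx (x : C) : complex.Re (x * x^*) = complex.Re `|x| ^+ 2.
  suff -> : x * x^* = (complex.Re `|x| ^+ 2)%:C by [].
  have -> : (complex.Re `|x| ^+ 2)%:C = (complex.Re `|x|)%:C ^+ 2 by rewrite rmorphXn.
  by rewrite -norm_ReE sqr_normc.
have ReeM (y : C) : complex.Re (e%:C * y) = e * complex.Re y.
  by case: y => y1 y2 /=; rewrite mul0r subr0.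
have ReU (x : C) : complex.Re (U x) = complex.Re (u x) + e * (complex.Re `|x| ^+ 2 - 1).
  by rewrite ReD ReeM ReB xx.
have Uc : {within @closed_disk R, continuous (fun x => complex.Re (U x))}.
  have -> : (fun x => complex.Re (U x)) = (fun x => complex.Re (u x) + e * (complex.Re `|x| ^+ 2 - 1)).
    by apply/funext => x; rewrite ReU.
  move=> x; apply: cvgD; first exact: uc.
  have : {within @closed_disk R, continuous (fun x : C => e * (complex.Re `|x| ^+ 2 - 1))}.
    apply: continuous_subspaceT => y.
    apply: (@continuous_comp _ _ _ (fun x : C => complex.Re `|x|) (fun t : R => e * (t ^+ 2 - 1))).
      exact: continuous_norm_Re.
    apply: cvgM; first exact: cvg_cst.
    by apply: cvgB; [exact: exprn_continuous|exact: cvg_cst].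
  exact.
have zd : closed_disk z by rewrite /closed_disk /= -lecR -norm_ReE ltW.
have [m /set_mem md Mm] := compact_EVT_max (ex_intro _ _ zd) (@closed_disk_compact R) Uc.
have Um : 0 < complex.Re (U m).
  apply: lt_le_trans (Mm z (mem_set zd)); rewrite ReU.
  have : 0 <= e * complex.Re `|z| ^+ 2 by rewrite mulr_ge0 ?sqr_ge0 // ltW.
  rewrite mulrBr mulr1; have : complex.Re (u z) = 2 * e by rewrite /e mulrC divfK ?pnatr_eq0.
  by lra.
have m1 : `|m| < 1.
  rewrite lt_neqAle norm_ReE -[1]/((1 : R)%:C) lecR md andbT -norm_ReE.
  apply/eqP => m1; move: Um; rewrite ReU m1 /= expr1n subrr mulr0 addr0 ltNge.
  by rewrite ub.
have [al [be [a [b [s [J s0]]]]]] := uj m m1.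
have J' := jetD J (jetM (jet_cst m e%:C)
  (jetD (jetM (jet_id m) (jet_conj (jet_id m))) (jet_cst m (-1)))).
have loc : \forall h \near (0 : C), complex.Re (U (m + h)) <= complex.Re (U m).
  have m1' : 0 < 1 - `|m| by rewrite subr_gt0.
  have [d d0 Hd] := near0_radius (near0_norm_lt m1').
  apply: (radius_near0 d0) => h /Hd hm; apply: Mm; apply: mem_set.
  rewrite /closed_disk /= -lecR -norm_ReE (le_trans (ler_normD _ _)) // -lerBrDl ltW //.
have := local_max_jet J' loc.
rewrite conjc0 conjc1 !(mulr0, mul0r, mulr1, addr0, add0r) ReD /=.
by move: e0 s0; lra.
Qed.

End Landscape.

(** * The landscape in the disk and its critical equation *)

Section CriticalPoints.
Variable R : realType.
Local Notation C := R[i].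
Local Notation conjp := (map_poly (@conjc R)).
Implicit Types (p Q : {poly C}).

Definition disk_landscape p Q (x : C) : C :=
  2^-1 * (Q.[x] + (Q.[x])^*) + -1 * (2^-1 * (p.[x] * (p.[x])^*)).

(** The mixed coefficient corresponds to the Laplacian -2 |p'|^2, that of the pull-back by [p] of a
    function with Laplacian -2. *)
Lemma jet_disk_landscape p Q z : exists be a b,
  jet (disk_landscape p Q) z (disk_landscape p Q z)
    (2^-1 * ((deriv Q).[z] - (deriv p).[z] * (p.[z])^*)) be a b
    (- (2^-1 * ((deriv p).[z] * ((deriv p).[z])^*))).
Proof.
have [aq Jq] := jet_poly Q z; have [ap Jp] := jet_poly p z.
have J := jetD (jetM (jet_cst z 2^-1) (jetD Jq (jet_conj Jq)))
   (jetM (jet_cst z (-1)) (jetM (jet_cst z 2^-1) (jetM Jp (jet_conj Jp)))).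
rewrite !conjc0 in J.
eexists.
apply: (jet_coef_eq J).
- by [].
- by rewrite !mul0r !mulr0 !addr0 !add0r mulN1r -mulrBr.
- reflexivity.
by move: ((deriv p).[z]) ((deriv Q).[z]) (p.[z]) (Q.[z]) => *; ring.
Qed.

(** Twice the derivative of [disk_landscape] in h, with [x^*] replaced by an independent outer
    variable y. *)
Definition critical_form p Q : {poly {poly C}} :=
  (deriv Q)%:P - (deriv p)%:P * map_poly polyC (conjp p).

Lemma horner_critical_form p Q (x y : C) :
  (critical_form p Q).[y%:P].[x] = (deriv Q).[x] - (deriv p).[x] * (p.[y^*])^*.
Proof.
have <- : (conjp p).[y] = (p.[y^*])^* by rewrite -[in LHS](conjcK y) horner_map.
rewrite /critical_form hornerD hornerN hornerC hornerM hornerC horner_map /=.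
by rewrite hornerD hornerN hornerM hornerC.
Qed.

Lemma size_critical_form p Q n : size p = n.+1 -> (size Q <= n.+1)%N ->
  (size (critical_form p Q) <= n.+1)%N /\ (sizeY (critical_form p Q) <= n)%N.
Proof.
move=> sp sQ.
have sd (r : {poly C}) : (size r <= n.+1)%N -> (size (deriv r) <= n)%N.
  move=> sr; have [->|r0] := eqVneq r 0; first by rewrite deriv0 size_poly0.
  by rewrite -ltnS (leq_trans (lt_size_deriv r0)).
have s1 (r : {poly {poly C}}) (d : {poly C}) : (size (d%:P * r)%R <= size r)%N.
  rewrite (leq_trans (size_polyMleq _ _)) // size_polyC.
  by case: (_ != _); rewrite ?add1n ?add0n ?leq_pred.
have scj : size (conjp p) = n.+1 by rewrite size_map_inj_poly ?rmorph0 //; exact: (can_inj (@conjcK R)).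
split.
  rewrite (leq_trans (size_polyD _ _)) // geq_max size_polyN.
  rewrite (leq_trans (size_polyC_leq1 _)) //= (leq_trans (s1 _ _)) //.
  by rewrite size_map_polyC scj.
rewrite sizeYE /critical_form rmorphB rmorphM /= !swapXY_polyC swapXY_map_polyC.
rewrite (leq_trans (size_polyD _ _)) // geq_max size_polyN size_map_polyC.
rewrite sd //= mulrC (leq_trans (s1 _ _)) // size_map_polyC sd // sp //.
Qed.

Lemma card_le_seq (T : choiceType) (rs : seq T) N : (size rs <= N)%N ->
  ([set` rs] #<= `I_N)%card.
Proof.
case: rs => [|x0 rs] sN; first by rewrite set_nil; exact: card_ge0.
apply: card_le_trans (_ : (nth x0 (x0 :: rs) @` `I_N #<= `I_N)%card); last exact: card_image_le.
apply: subset_card_le => x /= xr; exists (index x (x0 :: rs)); last exact: nth_index.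
have xs : (index x (x0 :: rs) < size (x0 :: rs))%N by rewrite index_mem.
exact: leq_trans xs sN.
Qed.

Lemma card_le_roots (T : choiceType) (A : set T) (F : C -> T) (r : {poly C}) N :
  r != 0 -> (size r <= N.+1)%N ->
  (forall t, A t -> exists2 x, root r x & F x = t) -> (A #<= `I_N)%card.
Proof.
move=> r0 sr AF; have [rs rE] := closed_field_poly_normal r.
have srs : size r = (size rs).+1 by rewrite {1}rE size_scale ?lead_coef_eq0 // size_prod_XsubC.
apply: card_le_trans (_ : ([set` map F rs] #<= _)%card); last first.
  by apply: card_le_seq; rewrite size_map -ltnS -srs.
apply: subset_card_le => t /AF [x rx <-] /=.
by apply: map_f; move: rx; rewrite rE rootZ ?lead_coef_eq0 // root_prod_XsubC.
Qed.

End CriticalPoints.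

(** * Pull-back of the landscape function to the disk *)

Section LandscapePullback.
Variable R : realType.
Local Notation C := R[i].
Variables (Omega : set C) (p Q : {poly C}) (n : nat) (v : C -> R).
Hypothesis Omega_open : open Omega.
Hypothesis sp : size p = n.+1.
Hypothesis inj_p : forall x y : C, `|x| < 1 -> `|y| < 1 -> p.[x] = p.[y] -> x = y.
Hypothesis p_in : forall x : C, `|x| < 1 -> Omega p.[x].
Hypothesis p_surj : forall z, Omega z -> exists2 x : C, `|x| < 1 & p.[x] = z.
Hypothesis hQ : forall z, `|z| = 1 -> Q.[z] + (Q.[z])^* = p.[z] * (p.[z])^*.
Hypothesis v_landscape : landscape_function Omega v.

Lemma nbhs_horner (x w : C) (B : set C) : p.[x] = w -> nbhs w B ->
  \forall h \near (0 : C), B p.[x + h].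
Proof.
move=> pxw nB; have [d d0 H] := near0_radius ((nbhs0P B w).1 nB).
have [a J] := jet_poly p x.
have d2 : 0 < (d / 2)%:C by rewrite ltcR divr_gt0.
have [e e0 He] := near0_radius (jet_near0 J d2).
apply: (radius_near0 e0) => h /He.
rewrite pxw norm_ReE lecR => h2.
have -> : p.[x + h] = w + (p.[x + h] - w) by rewrite [RHS]addrC subrK.
by apply: H; rewrite (le_lt_trans h2) // ltr_pdivrMr // ltr_pMr // ltr1n.
Qed.

Lemma closure_circle (x : C) : `|x| = 1 -> closure Omega p.[x].
Proof.
move=> x1 B nB.
have [d d0 H] := near0_radius (nbhs_horner erefl nB).
pose t := Num.min (d / 2) (1 / 2).
have t0 : 0 < t by rewrite lt_min !divr_gt0.
have t1 : t < 1 by rewrite gt_min orbC ltr_pdivrMr // mul1r ltr1n.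
have td : t < d by rewrite gt_min ltr_pdivrMr // ltr_pMr // ltr1n.
have nr (a : R) : `|a%:C| = `|a|%:C :> C by rewrite normc_def /= expr0n addr0 sqrtr_sqr.
exists (p.[x + - (t%:C * x)]); split.
  apply: p_in; have -> : x + - (t%:C * x) = (1 - t)%:C * x by rewrite rmorphB rmorph1 mulrBl mul1r.
  rewrite normrM x1 mulr1 nr gtr0_norm ?subr_gt0 // -[ltRHS]/((1 : R)%:C) ltcR ltrBlDr ltrDl //.
by apply: H; rewrite normrN normrM x1 mulr1 nr gtr0_norm.
Qed.

Lemma boundary_circle (x : C) : `|x| = 1 -> boundary Omega p.[x].
Proof.
move=> x1; split; first exact: closure_circle.
move=> /interior_subset /p_surj [a a1 pa].
by have := univalent_boundary sp inj_p a1 x1; rewrite pa eqxx.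
Qed.

Lemma closure_closed_disk (t : C) : closed_disk t -> closure Omega p.[t].
Proof.
rewrite /closed_disk /= => td; have [t1|t1] := eqVneq `|t| 1; first exact: closure_circle.
apply: subset_closure; apply: p_in; rewrite lt_neqAle t1 /= norm_ReE.
by rewrite -[leRHS]/((1 : R)%:C) lecR.
Qed.

Lemma near_pullback (x : C) (A : set R) : closed_disk x -> nbhs (v p.[x]) A ->
  \forall t \near x, closed_disk t -> A (v p.[t]).
Proof.
move=> xd nA; have [_ vc _ _] := v_landscape.
pose B : set C := [set y | closure Omega y -> A (v y)].
have : closure Omega p.[x] by exact: closure_closed_disk.
have [w pxw] : exists w : C, p.[x] = w by exists p.[x].
rewrite pxw => clw; rewrite pxw in nA.
have H : nbhs w B by exact: ((subspace_continuousP _ _).1 vc w clw A nA).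
have [d d0 H'] := near0_radius (nbhs_horner pxw H).
apply: (nbhs0P (fun t => closed_disk t -> A (v p.[t])) x).2.
apply: (radius_near0 d0) => h /H' Bh td.
exact: Bh (closure_closed_disk td).
Qed.

Lemma pullback_within_continuous :
  {within @closed_disk R, continuous (fun x => v p.[x])}.
Proof.
apply/subspace_continuousP => x xd A nA.
exact: near_pullback xd nA.
Qed.

Lemma jet_pullback (z : C) : `|z| < 1 ->
  exists a b, jet (fun x => (v p.[x])%:C) z (v p.[z])%:C
    (((partial_x v p.[z])%:C / 2 - (partial_y v p.[z])%:C * ('i / 2)) * (deriv p).[z])
    (((partial_x v p.[z])%:C / 2 + (partial_y v p.[z])%:C * ('i / 2)) * ((deriv p).[z])^*)
    a b (- (2^-1 * ((deriv p).[z] * ((deriv p).[z])^*))).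
Proof.
move=> z1; have [v2 _ vlap _] := v_landscape.
have [a [b J]] := jet_class_C2 Omega_open (p_in z1) v2.
have [ap Jp] := jet_poly p z.
have [a2 [b2 J2]] := jet_comp_hol J Jp.
apply: (jet_coef_eq J2) => //.
rewrite vlap; last exact: p_in.
have -> : (- 2 / 4)%:C = - 2^-1 :> C.
  have -> : - 2 / 4 = - 2^-1 :> R by field.
  by rewrite rmorphN fmorphV rmorph_nat.
by rewrite mulNr.
Qed.

(** The mixed coefficients of the two sides cancel and both sides vanish on the circle; the maximum
    principle applies to the difference and to its opposite. *)
Lemma pullback_landscape (z : C) : `|z| < 1 -> (v p.[z])%:C = disk_landscape p Q z.
Proof.
move=> z1; have [_ _ _ v0] := v_landscape.
have wr x : disk_landscape p Q x = (complex.Re (disk_landscape p Q x))%:C.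
  rewrite ReJ_add; have -> : (disk_landscape p Q x)^* = disk_landscape p Q x.
    rewrite /disk_landscape !(conjcD, conjcM) conjc_half !conjcK.
    have -> : (-1 : C)^* = -1 by apply/eqP; rewrite eq_complex /= !oppr0 !eqxx.
    by rewrite [(Q.[x])^* + _]addrC [(p.[x])^* * _]mulrC.
  by rewrite mulrDl -splitr.
have wc : continuous (fun x => complex.Re (disk_landscape p Q x)).
  by move=> x; have [? [? [? J]]] := jet_disk_landscape p Q x; exact: jet_Re_continuous J.
have w0 x : `|x| = 1 -> disk_landscape p Q x = 0.
  by move=> x1; rewrite /disk_landscape hQ // mulN1r subrr.
have uj (e : C) x : `|x| < 1 -> exists al be a b s,
    jet (fun x => e * ((v p.[x])%:C + -1 * disk_landscape p Q x)) x
      (e * ((v p.[x])%:C + -1 * disk_landscape p Q x)) al be a b s /\ 0 <= complex.Re s.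
  move=> x1; have [a [b J]] := jet_pullback x1.
  have [? [? [? Jw]]] := jet_disk_landscape p Q x.
  have JJ := jetM (jet_cst x e) (jetD J (jetM (jet_cst x (-1)) Jw)).
  do 5 eexists; split; first exact: JJ.
  by rewrite (_ : complex.Re _ = complex.Re (0 : C)) //; congr complex.Re; ring.
have uc (e : R) : {within @closed_disk R, continuous
    (fun x => complex.Re (e%:C * ((v p.[x])%:C + -1 * disk_landscape p Q x)))}.
  have -> : (fun x => complex.Re (e%:C * ((v p.[x])%:C + -1 * disk_landscape p Q x))) =
    (fun x => e * (v p.[x] - complex.Re (disk_landscape p Q x))).
    apply/funext => x; rewrite [in LHS]wr.
    have -> : e%:C * ((v p.[x])%:C + -1 * (complex.Re (disk_landscape p Q x))%:C) =
      (e * (v p.[x] - complex.Re (disk_landscape p Q x)))%:C.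
      by rewrite mulN1r -rmorphB -rmorphM.
    by [].
  move=> x; apply: cvgM; first exact: cvg_cst.
  apply: cvgB; first exact: pullback_within_continuous.
  exact: (@continuous_subspaceT _ _ _ _ wc).
have ub (e : C) x : `|x| = 1 -> complex.Re (e * ((v p.[x])%:C + -1 * disk_landscape p Q x)) <= 0.
  by move=> x1; rewrite w0 // v0 ?mulr0 ?addr0 ?mulr0 //; exact: boundary_circle.
have := disk_max_principle (uc 1) (ub _) (uj _) z1.
have := disk_max_principle (uc (-1)) (ub _) (uj _) z1.
rewrite [disk_landscape p Q z]wr.
move: (complex.Re (disk_landscape p Q z)) => t; rewrite /= => h1 h2.
congr (_%:C); lra.
Qed.

(** At a critical point the coefficient of h in the expansion of v o p vanishes; by uniqueness so
    does that of [disk_landscape], which is half of the critical form. *)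
Lemma critical_point_pullback (z : C) : critical_points Omega v z ->
  exists x : C, [/\ `|x| < 1, p.[x] = z & real_eval (critical_form p Q) x = 0].
Proof.
move=> [zO vx vy]; have [x x1 pxz] := p_surj zO; exists x; split => //.
have [a [b J]] := jet_pullback x1.
have [? [? [? Jw]]] := jet_disk_landscape p Q x.
have near_eq : \forall h \near (0 : C), (v p.[x + h])%:C = disk_landscape p Q (x + h).
  have x1' : 0 < 1 - `|x| by rewrite subr_gt0.
  near=> h; apply: pullback_landscape; apply: (le_lt_trans (ler_normD _ _)).
  by rewrite -ltrBrDl; near: h; exact: near0_norm_lt.
have J' : jet (disk_landscape p Q) x _ _ _ _ _ _ := jet_near_eq near_eq J.
have [al0 _] := jet_unique Jw J'.
rewrite /real_eval horner_critical_form conjcK pxz.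
rewrite pxz vx vy !mul0r subrr mul0r in al0.
by move/eqP: al0; rewrite mulf_eq0 invr_eq0 pnatr_eq0 /= => /eqP.
Unshelve. all: by end_near. Qed.

End LandscapePullback.

Theorem theorem4p2 (R : realType) (Omega : set R[i]) (n : nat) (z1 : R[i])
    (phi : R[i] -> R[i]) (v : R[i] -> R)
    (Omega_domain : bounded_domain Omega)
    (Omega_smooth : smooth_boundary Omega)
    (Omega_sc : simply_connected Omega)
    (Omega_qd : quadrature_domain Omega n (fun _ : 'I_1 => z1))
    (phi_conf : conformal_map (@unit_disk R) Omega phi)
    (phi0 : phi 0 = z1)
    (phi_poly : exists p : {poly R[i]},
      size p = n.+1 /\ forall z, unit_disk z -> phi z = p.[z])
    (v_landscape : landscape_function Omega v) :
  (critical_points Omega v #<= `I_((2 * n - 1) ^ 2)%N)%card.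
Proof.
have [Oo _ _ _] := Omega_domain.
have [p [sp phiE]] := phi_poly.
have diskE (x : R[i]) : `|x| < 1 <-> unit_disk x.
  by rewrite /unit_disk -ball_normE /ball_ /= sub0r normrN.
have [_ [phi_in phi_inj phi_surj]] := phi_conf.
have p_in (x : R[i]) : `|x| < 1 -> Omega p.[x].
  by move=> /diskE xd; rewrite -phiE //; apply: phi_in.
have inj_p (x y : R[i]) : `|x| < 1 -> `|y| < 1 -> p.[x] = p.[y] -> x = y.
  move=> /diskE xd /diskE yd; rewrite -!phiE // => E.
  by apply: phi_inj => //; exact: mem_set.
have p_surj z : Omega z -> exists2 x : R[i], `|x| < 1 & p.[x] = z.
  by move=> /phi_surj [x xd <-]; exists x; [exact/diskE|rewrite phiE].
have n0 := univalent_degree_gt0 sp inj_p.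
have p'0 := univalent_deriv_neq0 sp inj_p.
have [Q [sQ hQ _ rQ]] := harmonic_extension p.
rewrite sp in sQ rQ.
pose f := critical_form p Q.
have crit z : critical_points Omega v z ->
    exists x, [/\ `|x| < 1, p.[x] = z & real_eval f x = 0].
  move=> zc; apply: (critical_point_pullback Oo sp inj_p p_in p_surj _ v_landscape zc).
  exact: hQ.
have fE x : real_eval f x = (deriv Q).[x] - (deriv p).[x] * (p.[x])^*.
  by rewrite /real_eval horner_critical_form conjcK.
(* (2n - 1)^2 is the square of (n - 1) + n; the cross term 2n(n - 1) is dropped. *)
have bound_ge : (n.-1 * n.-1 + n * n <= (2 * n - 1) ^ 2)%N.
  have -> : (2 * n - 1 = n.-1 + n)%N by case: (n) n0 => // k _; rewrite mul2n -addnn addSn subn1.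
  by rewrite sqrnD -!mulnn leq_addr.
(* If Q' = p' conj(p(conj y)) identically, a zero of [f] at x in the disk forces p(x) = p(conj y)
   because p'(x) is nonzero: there is at most one critical point. *)
have [[y fy]|fy] := pselect (exists y : R[i], f.[y%:P] = 0).
  have N1 : (size [:: p.[y^*]] <= (2 * n - 1) ^ 2)%N.
    by rewrite /= (leq_trans _ bound_ge) // (leq_trans _ (leq_addl _ _)) // muln_gt0 n0.
  apply: card_le_trans (card_le_seq N1); apply: subset_card_le => z /crit [x [x1 pz fx]].
  rewrite /= inE -pz; apply/eqP/(can_inj (@conjcK R))/(mulfI (p'0 x x1)).
  have := congr1 (horner^~ x) fy; rewrite horner0 horner_critical_form => E1.
  move/eqP: E1; move/eqP: fx; rewrite fE !subr_eq0 => /eqP <- /eqP <-.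
  by [].
have fy' y : f.[y%:P] != 0 by apply/eqP => E; apply: fy; exists y.
have f0 : f != 0 by apply/eqP => E; apply: fy; exists 0; rewrite E horner0.
have [sf sYf] := size_critical_form sp sQ.
have sYf' : (sizeY f <= n.-1.+1)%N by rewrite prednK.
have [c [f1 [r [hc ff r0 rs rr]]]] := hermitian_common_factor f0 fy' sf sYf' (leq_pred n) n0.
have cn0 x : `|x| < 1 -> real_eval c x != 0.
  apply: (@no_real_zero R p (deriv Q) (real_eval c) (real_eval f1)) => //.
  (* The degree being at least 1, the strict Hopf inequality holds on the circle, and a zero of [f]
     there would contradict it. *)
  - move=> z /[dup] z1' /(rQ (n0 : (1 < n.+1)%N)); apply: contraTneq => ->; by rewrite mulr0 ltxx.
  - by move=> z; exact: jet_real_eval.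
  - by move=> z; exact: jet_real_eval.
  - by move=> z; rewrite -[in RHS]hc /real_eval horner_hadj conjcK.
  - by move=> z; rewrite -fE ff /real_eval !hornerM.
apply: (@card_le_roots _ _ _ (horner p) r) => //.
  by rewrite (leq_trans rs) // ltnS.
move=> z /crit [x [x1 pz fx]]; exists x => //; apply: rr.
move: fx; rewrite ff /real_eval !hornerM => /eqP; rewrite mulf_eq0 => /orP[|/eqP//].
by move/negP: (cn0 x x1).
Qed.
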